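(* Let $E$ be a complex Banach space of scalar sequences such that $c_{00}\subset E$ is dense and such that, whenever $x=(x_j)\in E$ and the scalar sequence $y=(y_j)$ satisfies $|y_j|\le|x_j|$ for all $j\in\mathbb N$, then $y\in E$ and $\|y\|_E\le\|x\|_E$. Let $(X_j)_{j\ge1}$ be a sequence of complex Banach spaces such that each $X_j$ has a $1$-unconditional Schauder basis $(e_{j,k})_{k\ge1}$. Define $$X=\left(\bigoplus_{j=1}^\infty X_j\right)_E=\left\{(x_j):x_j\in X_j,\ (\|x_j\|_{X_j})_{j\ge1}\in E\right\},\qquad \|(x_j)\|_X=\left\|(\|x_j\|_{X_j})_{j\ge1}\right\|_E .$$ Then the double family $(e_{j,k})_{j,k}$, viewed in the corresponding coordinate blocks of $X$, is a $1$-unconditional Schauder basis of $X$ under any enumeration of the double index set. Consequently, the associated monomials form a Schauder basis of $(\mathcal H(X),\tau_0)$ for every compatible ordering.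
   Context: $c_{00}$ is the space of finitely supported scalar sequences. A Schauder basis $(e_j)$ of a Banach space $X$ is $1$-unconditional if $\|\sum_j\lambda_jx_je_j\|\le\|\sum_jx_je_j\|$ whenever $\sum_j x_je_j\in X$ and $|\lambda_j|\le1$ for all $j$. $\mathcal H(X)$ is the space of entire holomorphic functions $X\to\mathbb C$, and $\tau_0$ is the compact-open topology, generated by the seminorms $\|f\|_K=\sup_{x\in K}|f(x)|$, $K\subset X$ compact. A Schauder basis of a locally convex space is understood in the usual sense (unique convergent expansions with continuous coefficient functionals). For a Schauder basis $(e_j)$ with coefficient functionals $(e_j^* )$, the associated monomials are $e^{*\alpha}(x)=\prod_je_j^*(x)^{\alpha_j}$, where $\alpha=(\alpha_j)_{j\ge1}$ ranges over finitely supported multi-indices with entries in $\mathbb N_0$; $|\alpha|=\sum_j\alpha_j$ is the degree and $\operatorname{len}(\alpha)=\max\operatorname{supp}(\alpha)$, $\operatorname{len}(0)=0$. Square order: for multi-indices of the same degree, $\alpha\prec\beta$ if either $\operatorname{len}(\alpha)<\operatorname{len}(\beta)$, or $\operatorname{len}(\alpha)=\operatorname{len}(\beta)$ and $\alpha_j<\beta_j$ for $j=\max\{i:\alpha_i\ne\beta_i\}$. An ordering (enumeration as a sequence) of all monomials is compatible if, for every $n\in\mathbb N_0$, its restriction to the degree-$n$ monomials agrees with the square order. *)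

(* Defs.v *)
From HB Require Import structures.
From mathcomp Require Import all_boot all_order all_algebra finmap.
From mathcomp Require Import all_classical all_reals all_analysis.
From mathcomp.real_closed Require Export complex.

Set Implicit Arguments.
Unset Strict Implicit.
Unset Printing Implicit Defensive.

Import Order.TTheory GRing.Theory Num.Theory.
Import numFieldNormedType.Exports.

Local Open Scope classical_set_scope.
Local Open Scope ring_scope.

Section SchauderBasis.
Context {K : numFieldType}.

Definition expansion {V : preTopologicalLmodType K} (e : nat -> V)
    (a : nat -> K) (x : V) : Prop :=
  series (fun n => a n *: e n) @ \oo --> x.

(* The coefficient functionals of [e]; meaningful when [x] has a unique
   expansion along [e]. *)
Definition coef {V : preTopologicalLmodType K} (e : nat -> V) (j : nat)
    (x : V) : K^o :=
  xget (fun=> 0) [set a | expansion e a x] j.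

(* [V] only has to carry a topology and a linear structure; this covers both
   normed spaces and locally convex function spaces. *)
Definition schauder_basis {V : preTopologicalLmodType K} (e : nat -> V) :
    Prop :=
  (forall x, exists! a, expansion e a x) /\
  (forall j, continuous (coef e j)).

Definition one_unconditional {V : normedModType K} (e : nat -> V) : Prop :=
  forall (x : nat -> K) (v : V) (lambda : nat -> K),
    expansion e x v -> (forall j, `|lambda j| <= 1) ->
    exists2 w : V, expansion e (fun j => lambda j * x j) w & `|w| <= `|v|.

Definition one_unconditional_basis {V : completeNormedModType K}
    (e : nat -> V) : Prop :=
  schauder_basis e /\ one_unconditional e.

End SchauderBasis.

(* Coordinates are indexed from 0, hence the successor in [mlen]: with
   coordinates indexed from 1 it is the maximum of the support. *)
Definition multiindex := {fsfun nat -> nat with 0%N}.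

Definition mdeg (alpha : multiindex) : nat :=
  (\sum_(j <- finsupp alpha) alpha j)%N.

Definition mlen (alpha : multiindex) : nat :=
  (\max_(j <- finsupp alpha) j.+1)%N.

Definition square_lt (alpha beta : multiindex) : Prop :=
  (mlen alpha < mlen beta)%N \/
  mlen alpha = mlen beta /\
  exists j : nat, [/\ alpha j <> beta j,
    forall i, alpha i <> beta i -> (i <= j)%N & (alpha j < beta j)%N].

Definition compatible (A : nat -> multiindex) : Prop :=
  bijective A /\
  forall m n, mdeg (A m) = mdeg (A n) ->
    (square_lt (A m) (A n) <-> (m < n)%N).

Definition monomial {K : numFieldType} {V : normedModType K} (e : nat -> V)
    (alpha : multiindex) (x : V) : K^o :=
  \prod_(j <- finsupp alpha) coef e j x ^+ alpha j.

(* [differentiable] is Frechet differentiability over [K], so for [K = R[i]]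
   these are the entire functions on [V]. *)
Section Holomorphic.
Context {K : numFieldType} (V : normedModType K).

Definition holomorphic : {pred V -> K^o} :=
  [pred f : V -> K^o | `[< forall x, differentiable f x >]].

Lemma holomorphic_submod_closed : submod_closed holomorphic.
Proof.
split=> [|a f g /asboolP df /asboolP dg]; apply/asboolP => x.
  exact: differentiable_cst.
by apply: differentiableD => //; exact: differentiableZ.
Qed.

HB.instance Definition _ := GRing.isSubmodClosed.Build _ _ holomorphic
  holomorphic_submod_closed.

Record holo := Holo { holo_val :> V -> K^o ; _ : holo_val \in holomorphic }.

HB.instance Definition _ := [isSub for holo_val].
HB.instance Definition _ := [Choice of holo by <:].
HB.instance Definition _ := [SubChoice_isSubLmodule of holo by <:].

(* Uniform convergence on compact sets is the topology generated by the
   seminorms sup_C |f|, C compact. *)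
HB.instance Definition _ := Uniform.copy holo
  (@initial_topology holo {family compact, V -> K^o} holo_val).

End Holomorphic.

Section SequenceSpace.
Context {K : numFieldType}.

Definition c00 : set (nat -> K^o) :=
  [set y | exists N, forall j, (N <= j)%N -> y j = 0].

(* A Banach space of sequences is a Banach space together with an injective
   linear map to the space of all sequences, identifying its elements with
   sequences. *)
Record solidSeqSpace := SolidSeqSpace {
  seq_carrier :> completeNormedModType K ;
  seq_of : {linear seq_carrier -> (nat -> K^o)} ;
  seq_of_inj : injective seq_of ;
  c00_sub : c00 `<=` range seq_of ;
  c00_dense : dense (seq_of @^-1` c00) ;
  seq_solid : forall (x : seq_carrier) (y : nat -> K^o),
    (forall j, `|y j| <= `|seq_of x j|) ->
    exists2 z : seq_carrier, seq_of z = y & `|z| <= `|x|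
}.

(* The element of [E] with underlying sequence [y], for [y] in [E]. *)
Definition to_space (E : solidSeqSpace) (y : nat -> K^o) : E :=
  xget 0 [set s : E | seq_of E s = y].

End SequenceSpace.
Arguments solidSeqSpace : clear implicits.

Section ToSpace.
Context {K : numFieldType} {E : solidSeqSpace K}.

Lemma to_spaceK (y : nat -> K^o) :
  range (seq_of E) y -> seq_of E (to_space E y) = y.
Proof.
by move=> [s _ sy]; rewrite /to_space; case: xgetP => // /(_ s) /(_ sy).
Qed.

Lemma to_space_seq (s : E) : to_space E (seq_of E s) = s.
Proof. by apply: (@seq_of_inj _ E); apply: to_spaceK; exists s. Qed.

Lemma range_dom (y y' : nat -> K^o) : range (seq_of E) y' ->
  (forall j, `|y j| <= `|y' j|) -> range (seq_of E) y.
Proof.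
by move=> [s _ <-] /(@seq_solid _ E)[z zy _]; exists z.
Qed.

Lemma to_space_dom (y y' : nat -> K^o) : range (seq_of E) y' ->
  (forall j, `|y j| <= `|y' j|) -> `|to_space E y| <= `|to_space E y'|.
Proof.
by move=> [s _ <-] /(@seq_solid _ E)[z <- zs]; rewrite !to_space_seq.
Qed.

End ToSpace.

Section ESum.
Context {K : numFieldType} (E : solidSeqSpace K).
Variable X : nat -> completeNormedModType K.

Definition norm_seq (x : forall j, X j) : nat -> K^o := fun j => `|x j|.

Record bsum := BSum {
  bsum_val :> forall j, X j ;
  bsumP : range (seq_of E) (norm_seq bsum_val)
}.

HB.instance Definition _ := gen_eqMixin bsum.
HB.instance Definition _ := gen_choiceMixin bsum.

Lemma bsum_ext (x y : bsum) : (forall j, x j = y j) -> x = y.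
Proof.
case: x y => [x px] [y py] /= xy.
have {}xy : x = y by exact: functional_extensionality_dep.
by case: y / xy py => py; congr BSum; exact: Prop_irrelevance.
Qed.

Fact bsum_zero_subproof : range (seq_of E) (norm_seq (fun j => 0 : X j)).
Proof.
exists 0 => //; rewrite linear0; apply/funext => j.
by rewrite /norm_seq normr0.
Qed.

Definition bsum_zero := BSum bsum_zero_subproof.

Fact bsum_opp_subproof (x : bsum) :
  range (seq_of E) (norm_seq (fun j => - x j)).
Proof. by apply: range_dom (bsumP x) _ => j; rewrite /norm_seq normrN. Qed.

Definition bsum_opp (x : bsum) := BSum (bsum_opp_subproof x).

Lemma rangeD (y z : nat -> K^o) :
  range (seq_of E) y -> range (seq_of E) z -> range (seq_of E) (y + z).
Proof. by move=> [s _ <-] [t _ <-]; exists (s + t); rewrite ?linearD. Qed.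

Lemma rangeZ (a : K) (y : nat -> K^o) :
  range (seq_of E) y -> range (seq_of E) (a *: y).
Proof. by move=> [s _ <-]; exists (a *: s); rewrite ?linearZ. Qed.

Fact bsum_dom_add (x y : bsum) j :
  `|norm_seq (fun j => x j + y j) j| <= `|(norm_seq x + norm_seq y) j|.
Proof.
rewrite [_ j in leRHS]/(_ + _) /norm_seq /=.
by rewrite normr_id (ger0_norm (addr_ge0 _ _))// ler_normD.
Qed.

Fact bsum_add_subproof (x y : bsum) :
  range (seq_of E) (norm_seq (fun j => x j + y j)).
Proof. exact: range_dom (rangeD (bsumP x) (bsumP y)) (bsum_dom_add x y). Qed.

Definition bsum_add (x y : bsum) := BSum (bsum_add_subproof x y).

Lemma norm_seqZ (a : K) (x : forall j, X j) :
  norm_seq (fun j => a *: x j) = `|a| *: norm_seq x.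
Proof. by apply/funext => j; rewrite /norm_seq normrZ. Qed.

Fact bsum_scale_subproof (a : K) (x : bsum) :
  range (seq_of E) (norm_seq (fun j => a *: x j)).
Proof. by rewrite norm_seqZ; apply/rangeZ/bsumP. Qed.

Definition bsum_scale (a : K) (x : bsum) := BSum (bsum_scale_subproof a x).

Let addA : associative bsum_add.
Proof. by move=> x y z; apply: bsum_ext => j /=; rewrite addrA. Qed.

Let addC : commutative bsum_add.
Proof. by move=> x y; apply: bsum_ext => j /=; rewrite addrC. Qed.

Let add0 : left_id bsum_zero bsum_add.
Proof. by move=> x; apply: bsum_ext => j /=; rewrite add0r. Qed.

Let addN : left_inverse bsum_zero bsum_opp bsum_add.
Proof. by move=> x; apply: bsum_ext => j /=; rewrite addNr. Qed.

HB.instance Definition _ := GRing.isZmodule.Build bsum addA addC add0 addN.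

Let scaleA (a b : K) (x : bsum) :
  bsum_scale a (bsum_scale b x) = bsum_scale (a * b) x.
Proof. by apply: bsum_ext => j /=; rewrite scalerA. Qed.

Let scale1 : left_id 1 bsum_scale.
Proof. by move=> x; apply: bsum_ext => j /=; rewrite scale1r. Qed.

Let scaleDr : right_distributive bsum_scale +%R.
Proof. by move=> a x y; apply: bsum_ext => j /=; rewrite scalerDr. Qed.

Let scaleDl (x : bsum) : {morph bsum_scale^~ x : a b / a + b}.
Proof. by move=> a b; apply: bsum_ext => j /=; rewrite scalerDl. Qed.

HB.instance Definition _ :=
  GRing.Zmodule_isLmodule.Build K bsum scaleA scale1 scaleDr scaleDl.

Definition bsum_norm (x : bsum) : K := `|to_space E (norm_seq x)|.

Let normD (x y : bsum) : bsum_norm (x + y) <= bsum_norm x + bsum_norm y.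
Proof.
apply: le_trans (to_space_dom (rangeD (bsumP x) (bsumP y))
  (bsum_dom_add x y)) _.
rewrite -(to_spaceK (bsumP x)) -(to_spaceK (bsumP y)) -linearD !to_space_seq.
exact: ler_normD.
Qed.

Let normZ (a : K) (x : bsum) : bsum_norm (a *: x) = `|a| * bsum_norm x.
Proof.
rewrite /bsum_norm [norm_seq _]norm_seqZ -(to_spaceK (bsumP x)) -linearZ.
by rewrite !to_space_seq normrZ normr_id.
Qed.

Let norm0_eq0 (x : bsum) : bsum_norm x = 0 -> x = 0.
Proof.
move=> /normr0_eq0 x0; apply: bsum_ext => j.
have := to_spaceK (bsumP x); rewrite x0 linear0 => /(congr1 (@^~ j)) /esym.
exact: normr0_eq0.
Qed.

HB.instance Definition _ :=
  Lmodule_isNormed.Build K bsum normD normZ norm0_eq0.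

Lemma bsum_normE (x : bsum) : `|x| = `|to_space E (norm_seq x)|.
Proof. by []. Qed.

Let nu (x : bsum) : E := to_space E (norm_seq x).

Let nuE (x : bsum) j : seq_of E (nu x) j = `|x j|.
Proof. by rewrite /nu to_spaceK //; exact: bsumP. Qed.

Let nu_lip (x y : bsum) : `|nu x - nu y| <= `|x - y|.
Proof.
rewrite bsum_normE -[nu x - nu y]to_space_seq.
apply: to_space_dom; first exact: bsumP.
move=> j; rewrite linearB [_ j in leLHS]/(_ - _) /= !nuE.
by rewrite /norm_seq normr_id; exact: ler_dist_dist.
Qed.

Let coord_bound j : exists2 C : K, 0 < C &
  forall s : E, `|seq_of E s j| <= C * `|s|.
Proof.
have [u _ uE] : range (seq_of E) (fun i => (i == j)%:R : K^o).
  by apply: c00_sub; exists j.+1 => i ji; rewrite gtn_eqF.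
have u0 : 0 < `|u|.
  rewrite normr_gt0; apply/eqP => u0.
  have := congr1 (@^~ j) uE; rewrite u0 linear0 eqxx => /eqP.
  by rewrite eq_sym oner_eq0.
exists `|u|^-1; first by rewrite invr_gt0.
move=> s; rewrite ler_pdivlMl// mulrC -normrZ.
have [|w ws wle] := @seq_solid _ E s (seq_of E (seq_of E s j *: u)).
  move=> i; have -> : seq_of E (seq_of E s j *: u) i =
      seq_of E s j * (i == j)%:R by rewrite linearZ uE.
  by case: eqP => [->|_]; rewrite ?mulr1// mulr0 normr0.
by move/seq_of_inj: ws wle => ->.
Qed.

Let lip_cvg (U : normedModType K) (W : completeNormedModType K) (f : U -> W)
    (C : K) (F : set_system U) : ProperFilter F -> 0 < C ->
  (forall x y, `|f x - f y| <= C * `|x - y|) -> cauchy F -> cvg (f @ F).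
Proof.
move=> FF C0 fC Fc; apply: cauchy_cvg; apply: cauchy_exP => _/posnumP[e].
have /cauchyP Fc' := Fc.
have [|x Fx] := Fc' (C^-1 * e%:num); first by rewrite mulr_gt0 ?invr_gt0.
exists (f x); suff: F (f @^-1` ball (f x) e%:num) by [].
apply: filterS Fx => y; rewrite /preimage -!ball_normE /= => xy.
by rewrite (le_lt_trans (fC _ _))// -ltr_pdivlMl.
Qed.

Let bsum_complete (F : set_system bsum) :
  ProperFilter F -> cauchy F -> cvg F.
Proof.
move=> FF Fc.
have Fcoord j : cvg ((fun x : bsum => x j) @ F).
  have [C C0 hC] := coord_bound j.
  apply: (@lip_cvg _ _ _ C) => // x y.
  have := hC (nu (x - y)); rewrite nuE normr_id => /le_trans; exact.
pose L j := lim ((fun x : bsum => x j) @ F).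
have key (z : bsum) : exists2 t : E,
    (fun y => nu (y - z)) @ F --> t & seq_of E t = norm_seq (fun j => L j - z j).
  have : cvg ((fun y => nu (y - z)) @ F).
    apply: (@lip_cvg _ _ _ 1) => // x y; rewrite mul1r.
    apply: le_trans (nu_lip _ _) _.
    by rewrite opprB addrA subrK.
  move=> /cvg_ex[/= t Ft]; exists t => //; apply/funext => j.
  have [C C0 hC] := coord_bound j.
  have h1 : seq_of E (nu (y - z)) j @[y --> F] --> seq_of E t j.
    apply/cvgrPdist_lt => _/posnumP[e].
    have e0 : 0 < C^-1 * e%:num by rewrite mulr_gt0 ?invr_gt0.
    move/cvgrPdist_lt : Ft => /(_ _ e0); apply: filterS => y ty.
    have := hC (t - nu (y - z)).
    rewrite linearB [_ j in leLHS]/(_ - _) /= => /le_lt_trans; apply.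
    by rewrite -ltr_pdivlMl.
  have h2 : seq_of E (nu (y - z)) j @[y --> F] --> (`|L j - z j| : K^o).
    under eq_fun do rewrite nuE.
    by apply: cvg_norm; apply: cvgB; [exact: Fcoord|exact: cvg_cst].
  exact: (cvg_unique _ h1 h2).
have [t _ tE] := key 0.
have pL : range (seq_of E) (norm_seq L).
  by exists t => //; rewrite tE; apply/funext => j; rewrite /norm_seq subr0.
apply/cvg_ex; exists (BSum pL); apply/cvgrPdist_le => _/posnumP[e].
have /cauchyP Fc' := Fc.
have e20 : 0 < e%:num / 2 / 2 :> K by [].
have [x Fx] := Fc' _ e20.
apply: filterS (Fx) => z; rewrite -ball_normE /= => xz.
have [u Fu uE] := key z.
have -> : `|BSum pL - z| = `|u|.
  by rewrite bsum_normE -[u]to_space_seq uE.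
have e2 : 0 < e%:num / 2 :> K by [].
move/cvgrPdist_lt : Fu => /(_ _ e2) Fu.
have [y [uy]] := @filter_ex _ F FF _ (@filterI _ F _ _ _ Fu Fx).
rewrite -ball_normE /= => xy.
rewrite -(subrK (nu (y - z)) u) (splitr e%:num).
apply: le_trans (ler_normD _ _) _; apply: lerD; first exact: ltW.
rewrite -[leLHS]/(`|y - z|) -(subrKA x) (splitr (e%:num / 2)).
apply: le_trans (ler_normD _ _) _; apply: lerD; last exact: ltW.
by rewrite distrC ltW.
Qed.

HB.instance Definition _ := Uniform_isComplete.Build bsum bsum_complete.

Fact bsum_in_subproof j (v : X j) :
  range (seq_of E) (norm_seq (eqtype.dfwith (fun i => 0 : X i) v)).
Proof.
apply: c00_sub; exists j.+1 => i ji.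
by rewrite /norm_seq eqtype.dfwith_out ?normr0// ltn_eqF.
Qed.

Definition bsum_in j (v : X j) : bsum := BSum (bsum_in_subproof v).

End ESum.

(* Main.v *)
From HB Require Import structures.
Require Import Defs.
From mathcomp Require Import all_boot all_order all_algebra finmap.
From mathcomp Require Import all_classical all_reals all_analysis.
From mathcomp.real_closed Require Import complex.
From mathcomp Require Import ring lra zify.

(** Direct sum.  A multiplier with entries in the closed unit disc acts on each
    block with norm at most one, and solidity of [E] carries this to the sum.
    Density of [c00] together with the expansions in the blocks makes the
    vectors with finitely many coordinates dense, so the finite coordinate
    projections, being uniformly bounded, converge to the identity along any
    enumeration; coordinates are continuous, hence expansions are unique
    ([sum_basis_unconditional]).

    Monomial basis.  This part holds for the monomials of every 1-unconditional
    basis of a complex Banach space ([monomial_basis]).  It applies a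
    Grunblum-type criterion ([schauder_criterion]): the partial sums of
    polynomials have to be equicontinuous for the compact-open topology, and
    the polynomials have to be dense.

    Equicontinuity ([msum_bound]).  On the multi-indices of degree [n] the
    square order is the comparison of the last differing coordinate.  Hence
    the multi-indices of degree [n] up to a given one are a disjoint union of
    [n + 1] sets, each of them prescribing the exponents of all coordinates from some
    coordinate on.  To extract the terms with prescribed exponents from a
    polynomial is to average it over rotations of coordinates by roots of
    unity, which does not increase its supremum over a solid set.  As a
    polynomial of degree [n] is [2 ^ n] times smaller on a set than on the
    double of that set, the bounds [(n + 1) / 2 ^ n] add up to [4], whatever
    the interleaving of the degrees is.  The solid hull of a compact set is
    compact by Tychonoff's theorem ([compact_solid_hull]).

    Density ([polynomial_dense]).  On a compact set, [f] is uniformly close to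
    its restriction to the span of finitely many basis vectors.  There, one
    coordinate after the other is replaced by its Lagrange interpolation at
    the [2 ^ N]-th roots of unity on a large circle.  That these interpolation
    polynomials converge is a discrete form of Cauchy's formula
    ([cauchy_star]), which is proved by Goursat's bisection applied to finite
    sums over polar grids in place of contour integrals. *)

Set Implicit Arguments.
Unset Strict Implicit.
Unset Printing Implicit Defensive.
Import Order.TTheory GRing.Theory Num.Theory.
Import numFieldNormedType.Exports.
Import ComplexField.Normc.

(** * Nested dyadic squares and discrete contour sums *)

Section Bisection.
Local Open Scope ring_scope.
Context {R : realType}.

Lemma dyadic_gt0 j : 0 < 2 ^+ j :> R. Proof. by rewrite exprn_gt0. Qed.

(** Compactness of the unit square in the form that Goursat's bisection needs.
    The left endpoints of the chosen intervals increase and stay below all the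
    right endpoints, so each coordinate of the limit point is a supremum. *)
Lemma quadrisection (Bad : nat -> nat -> nat -> Prop) :
  Bad 0 0 0 ->
  (forall j a b, Bad j a b ->
     exists d e : bool, Bad j.+1 (a.*2 + d)%N (b.*2 + e)%N) ->
  exists x y : R, forall j, exists a b, [/\ Bad j a b,
    a%:R / 2 ^+ j <= x <= a.+1%:R / 2 ^+ j &
    b%:R / 2 ^+ j <= y <= b.+1%:R / 2 ^+ j].
Proof.
move=> Bad0 BadS.
have /choice[F FP] : forall q : nat * nat * nat, exists q' : nat * nat * nat,
    Bad q.1.1 q.1.2 q.2 -> [/\ Bad q'.1.1 q'.1.2 q'.2, q'.1.1 = q.1.1.+1,
      exists d : bool, q'.1.2 = (q.1.2.*2 + d)%N &
      exists d : bool, q'.2 = (q.2.*2 + d)%N].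
  move=> [[j a] b] /=; have [B|nB] := pselect (Bad j a b); last by exists (0,0,0)%N.
  have [d [e B']] := BadS _ _ _ B.
  by exists (j.+1, (a.*2 + d)%N, (b.*2 + e)%N) => _; split=> //; [exists d|exists e].
pose q j := iter j F (0, 0, 0)%N.
have qB j : Bad (q j).1.1 (q j).1.2 (q j).2 /\ (q j).1.1 = j.
  elim: j => [//|j [B jE]]; have [B' E _ _] := FP _ B.
  by rewrite /q iterS -/(q j); split=> //; rewrite E jE.
have lim_pt (u : nat -> nat) : (forall j, exists d : bool, u j.+1 = (u j).*2 + d)%N ->
    exists x : R, forall j, (u j)%:R / 2 ^+ j <= x <= (u j).+1%:R / 2 ^+ j.
  move=> uS.
  have mono j n : (u j)%:R / 2 ^+ j <= (u (j + n)%N)%:R / 2 ^+ (j + n) :> R /\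
      (u (j + n)%N).+1%:R / 2 ^+ (j + n) <= (u j).+1%:R / 2 ^+ j :> R.
    elim: n => [|n [ih1 ih2]]; first by rewrite addn0.
    have [d dE] := uS (j + n)%N.
    have P0 := dyadic_gt0 (j + n).
    have P1 : 2 ^+ (j + n) != 0 :> R by rewrite gt_eqF.
    rewrite addnS dE exprS; split.
      apply: le_trans ih1 _; rewrite ler_pdivrMr//.
      rewrite [leRHS](_ : _ = (((u (j + n)%N).*2 + d)%N)%:R / 2); last by field.
      rewrite ler_pdivlMr// -muln2 natrD natrM; case: d {dE} => /=; lra.
    apply: le_trans ih2; rewrite ler_pdivlMr//.
    rewrite [leLHS](_ : _ = (((u (j + n)%N).*2 + d)%N.+1)%:R / 2); last by field.
    rewrite ler_pdivrMr// -natrM ler_nat.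
    case: d {dE} => /=; lia.
  have cmp j k : (u j)%:R / 2 ^+ j <= (u k).+1%:R / 2 ^+ k :> R.
    have mid l : (u l)%:R / 2 ^+ l <= (u l).+1%:R / 2 ^+ l :> R.
      by rewrite ler_pM2r ?invr_gt0 ?dyadic_gt0// ler_nat.
    have [jk|kj] := leqP j k.
      by have [h _] := mono j (k - j)%N; rewrite subnKC// in h; exact: le_trans h (mid k).
    have [_ h] := mono k (j - k)%N; rewrite subnKC 1?ltnW// in h.
    exact: le_trans (mid j) h.
  pose A : set R := range (fun j : nat => (u j)%:R / 2 ^+ j).
  have hA : has_sup A.
    split; first by exists ((u 0%N)%:R / 2 ^+ 0), 0%N.
    by exists ((u 0%N).+1%:R / 2 ^+ 0) => _ [j _ <-].
  exists (sup A) => j; apply/andP; split.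
    by apply: ub_le_sup; [case: hA | exists j].
  apply: ge_sup; first by case: hA.
  by move=> _ [k _ <-].
have [j|x xP] := lim_pt (fun j => (q j).1.2).
  by have [B jE] := qB j; have [_ _ E _] := FP _ B.
have [j|y yP] := lim_pt (fun j => (q j).2).
  by have [B jE] := qB j; have [_ _ _ E] := FP _ B.
exists x, y => j; exists (q j).1.2, (q j).2; split=> //.
by have [] := qB j => + jE; rewrite {1}jE.
Qed.

End Bisection.

Section Circulation.
Local Open Scope ring_scope.
Context {K : comPzRingType}.

(** The discrete contour integral of [F] along the boundary of a rectangle of
    grid points: [v] and [w] weigh the edges in the two directions, and each
    edge is evaluated at its left endpoint. *)
Definition circ (v w : nat -> K) (F : nat -> nat -> K) (i0 i1 k0 k1 : nat) : K :=
  \sum_(k0 <= k < k1) v k * (F i1 k - F i0 k)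
  - \sum_(i0 <= i < i1) w i * (F i k1 - F i k0).

(** The edges shared by two adjacent rectangles occur with opposite signs. *)
Lemma circ_split v w F i0 i1 i2 k0 k1 k2 :
  (i0 <= i1)%N -> (i1 <= i2)%N -> (k0 <= k1)%N -> (k1 <= k2)%N ->
  circ v w F i0 i2 k0 k2 =
  circ v w F i0 i1 k0 k1 + circ v w F i1 i2 k0 k1 +
  (circ v w F i0 i1 k1 k2 + circ v w F i1 i2 k1 k2).
Proof.
move=> i01 i12 k01 k12; rewrite /circ.
rewrite (big_cat_nat k01 k12) (big_cat_nat i01 i12) /=.
have V a b : \sum_(a <= k < b) v k * (F i2 k - F i0 k) =
    \sum_(a <= k < b) v k * (F i2 k - F i1 k) + \sum_(a <= k < b) v k * (F i1 k - F i0 k).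
  by rewrite -big_split; apply: eq_bigr => k _ /=; ring.
have H a b : \sum_(a <= i < b) w i * (F i k2 - F i k0) =
    \sum_(a <= i < b) w i * (F i k2 - F i k1) + \sum_(a <= i < b) w i * (F i k1 - F i k0).
  by rewrite -big_split; apply: eq_bigr => k _ /=; ring.
rewrite !V !H; ring.
Qed.

(** The weights [(b - a) / a] discretise [du / u]. A constant contributes
    nothing because a weight depends on one index only, so opposite sides
    cancel; the function [u] contributes nothing because [a * ((b - a) / a)]
    telescopes around the boundary. *)
Lemma circ_affine v w F (s c : nat -> K) (A B : K) G i0 i1 k0 k1 :
  (i0 <= i1)%N -> (k0 <= k1)%N ->
  (forall i, w i * s i = s i.+1 - s i) ->
  (forall k, v k * c k = c k.+1 - c k) ->
  (forall i k, F i k = A + B * (s i * c k) + G i k) ->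
  circ v w F i0 i1 k0 k1 = circ v w G i0 i1 k0 k1.
Proof.
move=> i01 k01 ws vc FE; rewrite /circ.
have -> : \sum_(k0 <= k < k1) v k * (F i1 k - F i0 k) =
    \sum_(k0 <= k < k1) v k * (G i1 k - G i0 k) + B * (s i1 - s i0) * (c k1 - c k0).
  rewrite -(telescope_sumr _ k01) big_distrr -big_split /=.
  by apply: eq_bigr => k _; rewrite -vc !FE; ring.
have -> : \sum_(i0 <= i < i1) w i * (F i k1 - F i k0) =
    \sum_(i0 <= i < i1) w i * (G i k1 - G i k0) + B * (c k1 - c k0) * (s i1 - s i0).
  rewrite -(telescope_sumr _ i01) big_distrr -big_split /=.
  by apply: eq_bigr => k _; rewrite -ws !FE; ring.
ring.
Qed.

End Circulation.

(** * The unit circle and the real-valued modulus *)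

Lemma le_of_eq d (T : porderType d) (x y : T) : x = y -> (x <= y)%O.
Proof. by move->. Qed.

Section Cis.
Local Open Scope ring_scope.
Local Open Scope complex_scope.
Context {R : realType}.
Implicit Types s t : R.

(** The parametrisation [exp (2 * pi * i * t)] of the unit circle. *)
Definition cis t : R[i] := cos (2 * pi * t) +i* sin (2 * pi * t).

Lemma cis0 : cis 0 = 1.
Proof. by rewrite /cis mulr0 cos0 sin0. Qed.

Lemma cisD s t : cis (s + t) = cis s * cis t.
Proof.
rewrite /cis mulrDr cosD sinD; apply/eqP; rewrite eq_complex /= eqxx /=.
by rewrite addrC.
Qed.

Lemma cisMn t n : cis (n%:R * t) = cis t ^+ n.
Proof.
elim: n => [|n ih]; first by rewrite mul0r cis0.
by rewrite exprS -ih -cisD; congr cis; rewrite -natr1; ring.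
Qed.

Lemma cis_half : cis 2^-1 = -1.
Proof.
rewrite /cis; have -> : 2 * pi / 2 = pi :> R by field.
by rewrite cospi sinpi; apply/eqP; rewrite eq_complex /= oppr0 !eqxx.
Qed.

Lemma cis1 : cis 1 = 1.
Proof.
have -> : 1 = 2%:R * 2^-1 :> R by field.
by rewrite cisMn cis_half sqrrN expr1n.
Qed.

Lemma normc_cis t : normc (cis t) = 1.
Proof. by rewrite /= cos2Dsin2 sqrtr1. Qed.

Lemma cos_lip s t : `|cos s - cos t| <= `|s - t|.
Proof.
wlog st : s t / s <= t.
  by move=> H; have /orP[/H//|/H] := le_total s t; rewrite distrC [leRHS]distrC.
have [|x _ E] := @MVT_segment _ cos (- sin) _ _ st.
  exact: continuous_subspaceT (@continuous_cos R).
rewrite distrC E normrM [leRHS]distrC ler_piMl//=.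
by rewrite normrN ler_norml sin_geN1 sin_le1.
Qed.

Lemma sin_lip s t : `|sin s - sin t| <= `|s - t|.
Proof.
wlog st : s t / s <= t.
  by move=> H; have /orP[/H//|/H] := le_total s t; rewrite distrC [leRHS]distrC.
have [|x _ E] := @MVT_segment _ sin cos _ _ st.
  exact: continuous_subspaceT (@continuous_sin R).
rewrite distrC E normrM [leRHS]distrC ler_piMl//=.
by rewrite ler_norml cos_geN1 cos_le1.
Qed.

Lemma normc_le_ReIm (z : R[i]) : normc z <= `|complex.Re z| + `|complex.Im z|.
Proof.
case: z => a b /=; rewrite -[leRHS]ger0_norm ?addr_ge0// -sqrtr_sqr ler_wsqrtr//.
rewrite -[a ^+ 2]real_normK ?num_real// -[b ^+ 2]real_normK ?num_real//.
by have := normr_ge0 a; have := normr_ge0 b; nra.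
Qed.

Lemma cis_lip s t : normc (cis s - cis t) <= 4 * pi * `|s - t|.
Proof.
apply: le_trans (normc_le_ReIm _) _ => /=.
have := cos_lip (2 * pi * s) (2 * pi * t).
have := sin_lip (2 * pi * s) (2 * pi * t).
have -> : `|2 * pi * s - 2 * pi * t| = 2 * pi * `|s - t|.
  by rewrite -mulrBr normrM (ger0_norm (mulr_ge0 _ (pi_ge0 R))).
by move=> H1 H2; lra.
Qed.

End Cis.

Section NormC.
Local Open Scope ring_scope.
Local Open Scope complex_scope.
Context {R : rcfType}.
Implicit Types x y : R[i].

Lemma normc_ge0 x : 0 <= normc x.
Proof. by case: x => a b /=; exact: sqrtr_ge0. Qed.

Lemma normCE x : `|x| = (normc x)%:C.
Proof. by case: x. Qed.

Lemma le_normcB x y : normc (x - y) <= normc x + normc y.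
Proof. by apply: le_trans (le_normcD _ _) _; rewrite normcN. Qed.

Lemma normcR (a : R) : normc a%:C = `|a|.
Proof. by rewrite /= expr0n addr0 sqrtr_sqr. Qed.

Lemma le_normc_sum I (r : seq I) (P : pred I) (F : I -> R[i]) (G : I -> R) :
  (forall i, P i -> normc (F i) <= G i) ->
  normc (\sum_(i <- r | P i) F i) <= \sum_(i <- r | P i) G i.
Proof.
move=> FG; elim/big_ind2 : _ => // [|a b c d ab cd]; first by rewrite normc0.
by apply: le_trans (le_normcD _ _) (lerD _ _).
Qed.

Lemma normcX x n : normc (x ^+ n) = normc x ^+ n.
Proof. by elim: n => [|n ih]; rewrite ?normc1// !exprS normcM ih. Qed.

End NormC.

(** * A discrete Goursat theorem *)

Section Goursat.
Local Open Scope ring_scope.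
Local Open Scope complex_scope.
Context {R : realType}.

(** Complex differentiability at every point, measured with the real-valued
    modulus: the inequalities of the Goursat argument then live in a totally
    ordered field. *)
Definition cdiff (h : R[i] -> R[i]) := forall u0, exists A, forall e : R, 0 < e ->
  exists2 d, 0 < d & forall u, normc (u - u0) < d ->
    normc (h u - h u0 - A * (u - u0)) <= e * normc (u - u0).

Lemma circ_bound (v w : nat -> R[i]) G (M vb wb : R) i0 i1 k0 k1 :
  (i0 <= i1)%N -> (k0 <= k1)%N ->
  (forall i k, (i0 <= i <= i1)%N -> (k0 <= k <= k1)%N -> normc (G i k) <= M) ->
  (forall k, normc (v k) <= vb) -> (forall i, normc (w i) <= wb) ->
  normc (circ v w G i0 i1 k0 k1) <=
    2 * M * ((k1 - k0)%:R * vb + (i1 - i0)%:R * wb).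
Proof.
move=> i01 k01 GM vP wP; rewrite /circ.
have sub a b : normc a <= M -> normc b <= M -> normc (a - b) <= 2 * M.
  by move=> aM bM; apply: le_trans (le_normcB _ _) _; lra.
apply: le_trans (le_normcB _ _) _; rewrite mulrDr; apply: lerD.
  rewrite big_nat; apply: (@le_trans _ _ (\sum_(k0 <= k < k1 | (k0 <= k < k1)%N) (2 * M * vb))).
    apply: le_normc_sum => k /andP[k0k kk1]; rewrite normcM mulrC.
    have kk : (k0 <= k <= k1)%N by rewrite k0k ltnW.
    apply: ler_pM; [exact: normc_ge0|exact: normc_ge0| |exact: vP].
    by apply: sub; apply: GM => //; rewrite leqnn i01.
  by rewrite -big_nat sumr_const_nat -mulr_natl; apply: le_of_eq; ring.
rewrite big_nat; apply: (@le_trans _ _ (\sum_(i0 <= k < i1 | (i0 <= k < i1)%N) (2 * M * wb))).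
  apply: le_normc_sum => k /andP[k0k kk1]; rewrite normcM mulrC.
  have kk : (i0 <= k <= i1)%N by rewrite k0k ltnW.
  apply: ler_pM; [exact: normc_ge0|exact: normc_ge0| |exact: wP].
  by apply: sub; apply: GM => //; rewrite leqnn k01.
by rewrite -big_nat sumr_const_nat -mulr_natl; apply: le_of_eq; ring.
Qed.

Context (g : R[i] -> R[i]) (hg : cdiff g).
Context (c : R -> R[i]) (L B m : R).
Hypothesis c_lip : forall t t', normc (c t - c t') <= L * `|t - t'|.
Hypothesis c_bd : forall t, normc (c t) <= B.
Hypothesis m0 : 0 < m.
Hypothesis c_low : forall t, m <= normc (c t).
Hypothesis L0 : 0 < L.

Definition mesh (N i : nat) : R := i%:R / 2 ^+ N.

Lemma mesh_ge0 N i : 0 <= mesh N i.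
Proof. by rewrite divr_ge0// ltW// dyadic_gt0. Qed.

Lemma meshS N i : mesh N i.+1 - mesh N i = (2 ^+ N)^-1.
Proof. by rewrite /mesh -mulrBl -natr1 addrAC subrr add0r mul1r. Qed.

Lemma mesh_refine N j i : (j <= N)%N -> mesh N (i * 2 ^ (N - j)) = mesh j i.
Proof.
move=> jN; rewrite /mesh natrM natrX -{2}(subnK jN) exprD.
have := dyadic_gt0 (R := R) j; have := dyadic_gt0 (R := R) (N - j).
by move=> /gt_eqF/negbT ? /gt_eqF/negbT ?; field; apply/andP.
Qed.

(** The form [du / u] along the curve [c]. *)
Definition vweight N k := (c (mesh N k.+1) - c (mesh N k)) / c (mesh N k).

Lemma c_neq0 t : c t != 0.
Proof. by apply/eqP => c0; have := c_low t; rewrite c0 normc0 leNgt m0. Qed.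

Lemma vweight_bound N k : normc (vweight N k) <= L / m / 2 ^+ N.
Proof.
rewrite /vweight normcM normcV.
have mc : (normc (c (mesh N k)))^-1 <= m^-1 by rewrite lef_pV2 ?posrE ?(lt_le_trans m0).
apply: le_trans (ler_pM _ _ (c_lip _ _) mc) _; rewrite ?normc_ge0 ?invr_ge0 ?normc_ge0//.
by rewrite meshS ger0_norm ?invr_ge0 ?exprn_ge0//; apply: le_of_eq; ring.
Qed.

Section Radial.
Context (s0 : R).
Hypothesis hs0 : 0 < s0 < 1.

Let s x : R := s0 + (1 - s0) * x.
Let node N i k := (s (mesh N i))%:C * c (mesh N k).
Let w N i := ((s (mesh N i.+1) - s (mesh N i)) / s (mesh N i))%:C.

Let s_gt0 x : 0 <= x -> s0 <= s x.
Proof. by case/andP: hs0 => ? ? x0; rewrite /s lerDl mulr_ge0//; lra. Qed.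

Let wweight_bound N i : normc (w N i) <= s0^-1 / 2 ^+ N.
Proof.
case/andP: (hs0) => ? ?; rewrite /w normcR normrM /s opprD addrACA subrr add0r -mulrBr meshS normrM.
have := s_gt0 (mesh_ge0 N i); rewrite /s => sx.
have P : 0 <= (2 ^+ N)^-1 :> R by rewrite invr_ge0 ltW// dyadic_gt0.
have E : `|s0 + (1 - s0) * mesh N i| = s0 + (1 - s0) * mesh N i.
  by rewrite ger0_norm//; lra.
rewrite (ger0_norm P) normrV ?unitfE ?gt_eqF; try lra.
rewrite E.
rewrite [leRHS]mulrC [Num.norm (1 - s0)]ger0_norm; last lra.
apply: ler_pM.
- by apply: mulr_ge0 => //; lra.
- by rewrite invr_ge0; lra.
- by apply: ler_piMl => //; lra.
- by rewrite lef_pV2 ?posrE//; lra.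
Qed.

(** The contour sum over the cell [(a, b)] of level [j], computed on the finer
    mesh [2 ^- N]. The grid point [(i, k)] is the [k]-th point of the curve
    [c] contracted towards [0] by a factor between [s0] and [1], so that [0]
    is avoided. *)
Definition block N j a b := let n := (2 ^ (N - j))%N in
  circ (vweight N) (w N) (fun i k => g (node N i k))
    (a * n) (a.+1 * n) (b * n) (b.+1 * n).

Let itv_dist (a b x y : R) : a <= x <= b -> a <= y <= b -> `|x - y| <= b - a.
Proof. by move=> *; rewrite ler_norml; lra. Qed.

Let mesh_in N j a i : (j <= N)%N ->
  (a * 2 ^ (N - j) <= i <= a.+1 * 2 ^ (N - j))%N ->
  mesh j a <= mesh N i <= mesh j a.+1.
Proof.
move=> jN /andP[ai ia]; rewrite -!(mesh_refine _ jN).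
by rewrite !ler_pM2r ?invr_gt0 ?dyadic_gt0// !ler_nat ai ia.
Qed.

(** The first order expansion of [g] at the point with parameters [(x, y)] is
    invisible by [circ_affine]. The remainder is of the order of the diameter
    [2 ^- j] times an arbitrarily small constant, and it is summed along a
    boundary whose length is of the order [2 ^- j] as well. *)
Lemma small_block (x y e : R) : 0 < e -> exists J, forall N j a b,
  (J <= j)%N -> (j <= N)%N -> (a < 2 ^ j)%N ->
  mesh j a <= x <= mesh j a.+1 -> mesh j b <= y <= mesh j b.+1 ->
  normc (block N j a b) <= e / 4 ^+ j.
Proof.
move=> e0; have [/[dup] s00 ? s01] := andP hs0.
have B0 : 0 < B by apply: lt_le_trans m0 (le_trans (c_low 0) (c_bd 0)).
have W0 : 0 < L / m + s0^-1 by rewrite addr_gt0 ?divr_gt0 ?invr_gt0.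
have BL0 : 0 < B + L by rewrite addr_gt0.
have [A HA] := hg ((s x)%:C * c y).
have [|d d0 Hd] := HA (e / (2 * (B + L) * (L / m + s0^-1))).
  by rewrite divr_gt0 ?mulr_gt0.
have [J HJ] : exists J : nat, (B + L) / d < 2 ^+ J.
  exists (Num.truncn ((B + L) / d)).+1; apply: lt_le_trans (truncnS_gt _) _.
  by rewrite -natrX ler_nat ltnW// ltn_expl.
exists J => N j a b Jj jN aj xP yP.
have D0 : 0 < 2 ^+ j :> R by exact: dyadic_gt0.
have jd : (B + L) / 2 ^+ j < d.
  rewrite ltr_pdivrMr// mulrC -ltr_pdivrMr//; apply: lt_le_trans HJ _.
  by rewrite -!natrX ler_nat leq_pexp2l.
have near_node i k : (a * 2 ^ (N - j) <= i <= a.+1 * 2 ^ (N - j))%N ->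
    (b * 2 ^ (N - j) <= k <= b.+1 * 2 ^ (N - j))%N ->
    normc (node N i k - (s x)%:C * c y) <= (B + L) / 2 ^+ j.
  move=> /(mesh_in jN) iP /(mesh_in jN) kP.
  have ix := itv_dist iP xP; have ky := itv_dist kP yP.
  rewrite meshS in ix; rewrite meshS in ky.
  have x0 : 0 <= x by case/andP: xP => + _; apply: le_trans; exact: mesh_ge0.
  have x1 : x <= 1.
    case/andP: xP => _ /le_trans; apply.
    by rewrite /mesh ler_pdivrMr// mul1r -natrX ler_nat.
  rewrite /node [X in normc X](_ : _ = (s (mesh N i) - s x)%:C * c (mesh N k)
      + (s x)%:C * (c (mesh N k) - c y)); last first.
    by rewrite rmorphB /=; ring.
  apply: le_trans (le_normcD _ _) _; rewrite mulrDl !normcM !normcR.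
  apply: lerD.
    rewrite mulrC; apply: ler_pM; rewrite ?normc_ge0//.
    apply: le_trans ix; rewrite /s opprD addrACA subrr add0r -mulrBr normrM.
    by apply: ler_piMl => //; rewrite ger0_norm; lra.
  have S0 := s_gt0 x0; rewrite ger0_norm; last lra.
  have S1 : s x <= 1 by rewrite /s; nra.
  apply: (le_trans (ler_piMl (normc_ge0 _) S1)).
  by apply: le_trans (c_lip _ _) (ler_wpM2l (ltW L0) ky).
rewrite /block (@circ_affine _ _ _ _ (fun i => (s (mesh N i))%:C) (fun k => c (mesh N k))
  (g ((s x)%:C * c y) - A * ((s x)%:C * c y)) A
  (fun i k => g (node N i k) - g ((s x)%:C * c y) - A * (node N i k - (s x)%:C * c y))); first last.
- by move=> i k /=; rewrite /node; ring.
- by move=> k; rewrite /vweight divfK ?c_neq0.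
- move=> i; rewrite /w -rmorphM /= divfK ?rmorphB// gt_eqF//.
  by apply: lt_le_trans (s_gt0 (mesh_ge0 _ _)).
- by rewrite leq_mul2r leqnSn orbT.
- by rewrite leq_mul2r leqnSn orbT.
apply: (le_trans (circ_bound (M := e / (2 * (L / m + s0^-1)) / 2 ^+ j)
  _ _ _ (vweight_bound N) (wweight_bound N))).
- by rewrite leq_mul2r leqnSn orbT.
- by rewrite leq_mul2r leqnSn orbT.
- move=> i k iP kP /=; have nk := near_node _ _ iP kP.
  apply: le_trans (Hd _ (le_lt_trans nk jd)) _.
  apply: (le_trans (ler_wpM2l _ nk)); first by rewrite ltW// divr_gt0 ?mulr_gt0.
  apply: le_of_eq; field.
  by rewrite !gt_eqF// addr_gt0// ?mulr_gt0//.
rewrite !mulSn !addnK natrX.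
rewrite (_ : 4 ^+ j = 2 ^+ j * 2 ^+ j :> R); last by rewrite -exprMn; congr (_ ^+ _); lra.
have -> : 2 ^+ N = 2 ^+ (N - j) * 2 ^+ j :> R by rewrite -exprD subnK.
have := dyadic_gt0 (R := R) (N - j) => D0'.
apply: le_of_eq; field.
by rewrite !gt_eqF// addr_gt0// ?mulr_gt0//.
Qed.

Lemma block_split N j a b : (j < N)%N ->
  block N j a b = block N j.+1 a.*2 b.*2 + block N j.+1 a.*2.+1 b.*2 +
  (block N j.+1 a.*2 b.*2.+1 + block N j.+1 a.*2.+1 b.*2.+1).
Proof.
move=> jN; rewrite /block.
have -> : (2 ^ (N - j) = 2 * 2 ^ (N - j.+1))%N by rewrite -expnS subnSK.
have E x : (x * (2 * 2 ^ (N - j.+1)) = x.*2 * 2 ^ (N - j.+1))%N.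
  by rewrite mulnA muln2.
by rewrite !E doubleS; apply: circ_split; rewrite leq_mul2r leqnSn orbT.
Qed.

(** If the contour sum did not tend to [0], then for infinitely many meshes
    some quarter would carry at least a quarter of it. Iterating produces
    nested cells, which contradict [small_block] at their common point. *)
Lemma goursat (e : R) : 0 < e -> exists N0, forall N, (N0 <= N)%N ->
  normc (block N 0 0 0) < e.
Proof.
move=> e0; apply: contrapT => H.
pose Bad j a b := [/\ (a < 2 ^ j)%N, (b < 2 ^ j)%N & forall N0, exists2 N,
  (N0 <= N)%N && (j <= N)%N & e / 4 ^+ j <= normc (block N j a b)].
have [||x [y xy]] := quadrisection (R := R) (Bad := Bad).
- split=> // N0; apply: contrapT => nN; apply: H; exists N0 => N N0N.
  rewrite ltNge; apply/negP => eN; apply: nN.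
  by exists N; rewrite ?N0N// expr0 divr1.
- move=> j a b [aj bj Bjab]; apply: contrapT => noC.
  have child (d f : bool) : exists N0, forall N, (N0 <= N)%N -> (j < N)%N ->
      normc (block N j.+1 (a.*2 + d) (b.*2 + f)) < e / 4 ^+ j.+1.
    apply: contrapT => nN; apply: noC; exists d, f.
    split.
    + by rewrite expnS; case: d {nN}; lia.
    + by rewrite expnS; case: f {nN}; lia.
    move=> N0; apply: contrapT => nN0; apply: nN; exists N0 => N N0N jN.
    rewrite ltNge; apply/negP => eN; apply: nN0.
    by exists N => //; rewrite N0N.
  have [N1 H1] := child false false; have [N2 H2] := child true false.
  have [N3 H3] := child false true; have [N4 H4] := child true true.
  have [N /andP[NN jN]] := Bjab (N1 + N2 + N3 + N4 + j.+1)%N.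
  have jN' : (j < N)%N by lia.
  rewrite block_split//.
  have {}H1 := H1 N ltac:(lia) jN'; have {}H2 := H2 N ltac:(lia) jN'.
  have {}H3 := H3 N ltac:(lia) jN'; have {}H4 := H4 N ltac:(lia) jN'.
  rewrite !addn0 !addn1 in H1 H2 H3 H4.
  apply/negP; rewrite -ltNge.
  apply: le_lt_trans (le_normcD _ _) _.
  apply: le_lt_trans (lerD (le_normcD _ _) (le_normcD _ _)) _.
  rewrite [ltRHS](_ : _ = 4 * (e / 4 ^+ j.+1)); first by lra.
  by rewrite exprS; field; rewrite expf_neq0.
have e20 : 0 < e / 2 by lra.
have [J HJ] := small_block x y e20.
have [a [b [[aj bj HB] xP yP]]] := xy J.
have [N /andP[_ JN]] := HB 0%N; apply/negP; rewrite -ltNge.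
apply: le_lt_trans (HJ N J a b _ JN aj xP yP) _ => //.
by rewrite ltr_pM2r ?invr_gt0 ?exprn_gt0//; lra.
Qed.

End Radial.

Hypothesis c_per : c 1 = c 0.

(** The radial sides cancel because the curve is closed. So [goursat] compares
    the sums over the curve and over its contraction by [s0], and on the
    latter [g] is close to [g 0]. *)
Lemma cauchy_star (e : R) : 0 < e -> exists N0, forall N, (N0 <= N)%N ->
  normc (\sum_(0 <= k < 2 ^ N) vweight N k * (g (c (mesh N k)) - g 0)) < e.
Proof.
move=> e0.
have B0 : 0 < B by apply: lt_le_trans m0 (le_trans (c_low 0) (c_bd 0)).
have [A HA] := hg 0.
have [d d0 Hd] := HA 1 ltr01.
(* [q] bounds the increment of [g] so that the sum of the weights, at most
   [L / m], turns it into [e / 2] *)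
pose q := e / (2 * (L / m) * (normc A + 1)).
have q0 : 0 < q.
  by rewrite divr_gt0// !mulr_gt0 ?invr_gt0// ltr_wpDl ?normc_ge0.
pose s0 := Num.min (2^-1) (Num.min (d / 2 / B) (q / B)).
have s00 : 0 < s0 by rewrite /s0 !lt_min invr_gt0 ltr0n (divr_gt0 q0 B0) andbT divr_gt0// divr_gt0.
have s01 : 0 < s0 < 1.
  have : s0 <= 2^-1 by rewrite ge_min lexx.
  by rewrite s00 /=; lra.
have e20 : 0 < e / 2 by lra.
have [N0 HN0] := goursat s01 e20.
exists N0 => N /HN0; rewrite /block subn0 /circ !mul0n !mul1n.
have mesh1 : mesh N (2 ^ N) = 1 by rewrite /mesh natrX divff// gt_eqF ?dyadic_gt0.
have mesh0 : mesh N 0 = 0 by rewrite /mesh mul0r.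
rewrite [X in _ - X]big1 ?subr0; last first.
  by move=> i _; rewrite mesh1 mesh0 c_per subrr mulr0.
rewrite mesh1 mesh0 mulr1 mulr0 addr0 [s0 + _]addrC subrK => He.
rewrite [X in normc X](_ : _ =
   \sum_(0 <= k < 2 ^ N) vweight N k * (g (1%:C * c (mesh N k)) - g (s0%:C * c (mesh N k)))
 + \sum_(0 <= k < 2 ^ N) vweight N k * (g (s0%:C * c (mesh N k)) - g 0)); last first.
  rewrite -big_split; apply: eq_bigr => k _ /=.
  by rewrite -mulrDr addrA subrK mul1r.
apply: le_lt_trans (le_normcD _ _) _; rewrite [ltRHS](splitr e).
apply: ltr_leD => //.
apply: (@le_trans _ _ (\sum_(0 <= k < 2 ^ N) (L / m / 2 ^+ N * ((normc A + 1) * q)))).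
  apply: le_normc_sum => k _; rewrite normcM.
  apply: ler_pM; rewrite ?normc_ge0 ?vweight_bound//.
  have sB : s0 * normc (c (mesh N k)) <= s0 * B by rewrite ler_pM2l// c_bd.
  have nE : normc (s0%:C * c (mesh N k) - 0) = s0 * normc (c (mesh N k)).
    by rewrite subr0 normcM normcR gtr0_norm.
  have sd : s0 <= d / 2 / B by rewrite !ge_min lexx !orbT.
  have sq : s0 <= q / B by rewrite !ge_min lexx !orbT.
  rewrite ler_pdivlMr// in sd; rewrite ler_pdivlMr// in sq.
  have := Hd (s0%:C * c (mesh N k)); rewrite nE => /(_ ltac:(lra)) H.
  rewrite -[X in normc X](subrK (A * (s0%:C * c (mesh N k) - 0))).
  apply: le_trans (le_normcD _ _) _.
  rewrite [normc (A * _)]normcM nE.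
  have := normc_ge0 A; nra.
rewrite sumr_const_nat subn0 -(mulr_natl _ (2 ^ N)%N) natrX /q.
have := normc_ge0 A => A0.
apply: le_of_eq; field; rewrite !gt_eqF ?dyadic_gt0//; lra.
Qed.

End Goursat.

(** * Interpolation at roots of unity *)

Section RootsOfUnity.
Local Open Scope ring_scope.
Local Open Scope complex_scope.
Context {R : realType}.

Definition zeta (N k : nat) : R[i] := cis (mesh N k).

Lemma zetaE N k : zeta N k = zeta N 1 ^+ k.
Proof. by rewrite /zeta -cisMn /mesh mul1r. Qed.

Lemma zeta_order N : zeta N (2 ^ N) = 1.
Proof. by rewrite /zeta /mesh natrX divff ?cis1// gt_eqF ?dyadic_gt0. Qed.

Lemma zeta_half N : zeta N.+1 (2 ^ N) = -1.
Proof.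
rewrite /zeta /mesh natrX -cis_half; congr cis.
by rewrite exprS; field; rewrite gt_eqF ?dyadic_gt0.
Qed.

Lemma normc_zeta N k : normc (zeta N k) = 1.
Proof. exact: normc_cis. Qed.

Lemma zeta_neq0 N k : zeta N k != 0.
Proof.
apply/eqP => z0; have := normc_zeta N k.
by rewrite z0 normc0 => /eqP; rewrite eq_sym oner_eq0.
Qed.

(** The order divides [2 ^ N], and it is not a smaller power of [2] because
    the power [2 ^ N.-1] is [-1]. *)
Lemma zeta_prim N : (2 ^ N)%N.-primitive_root (zeta N 1).
Proof.
have := zeta_order N; rewrite zetaE => /prim_order_exists[|m mz].
  by rewrite expn_gt0.
case/(dvdn_pfactor _ _ (isT : prime 2)) => e eN mE; rewrite mE in mz.
move: eN; rewrite leq_eqVlt => /predU1P[E|]; first by rewrite -{1}E.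
case: N mz => // N mz eN.
have : zeta N.+1 1 ^+ (2 ^ N) = 1.
  move: (zeta _ _) mz => y my.
  by rewrite -(subnK (eN : (e <= N)%N)) expnD mulnC exprM (prim_expr_order my) expr1n.
rewrite -zetaE zeta_half => /eqP; rewrite eqNr oner_eq0//.
Qed.

Lemma zeta_mean N (a b : nat) : (a < 2 ^ N)%N -> (b < 2 ^ N)%N ->
  (2 ^+ N)^-1 * \sum_(k < 2 ^ N) (zeta N k ^+ a / zeta N k ^+ b) = (a == b)%:R.
Proof.
move=> aN bN; pose y := zeta N 1 ^+ a / zeta N 1 ^+ b.
have -> : \sum_(k < 2 ^ N) (zeta N k ^+ a / zeta N k ^+ b) = \sum_(k < 2 ^ N) y ^+ k.
  apply: eq_bigr => k _.
  by rewrite zetaE /y exprMn exprVn -!exprM mulnC [(k * b)%N]mulnC.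
have z0 := zeta_neq0 N 1.
have [ab|ab] := eqVneq a b.
  rewrite (eq_bigr (fun=> 1)) => [|k _]; last first.
    by rewrite /y ab divff ?expf_neq0// expr1n.
  by rewrite sumr_const card_ord natrX mulVf// expf_neq0// pnatr_eq0.
have y1 : y != 1.
  apply: contraNneq ab => y1.
  have : zeta N 1 ^+ a == zeta N 1 ^+ b.
    by rewrite -(mulr1 (zeta N 1 ^+ b)) -y1 /y; apply/eqP; field; rewrite !expf_neq0.
  by rewrite (eq_prim_root_expr (zeta_prim N)) !modn_small.
have yN : y ^+ (2 ^ N) = 1.
  rewrite /y exprMn exprVn -!exprM [(a * _)%N]mulnC [(b * _)%N]mulnC !exprM.
  by rewrite -zetaE zeta_order !expr1n divr1.
have /eqP := subrX1 y (2 ^ N); rewrite yN subrr eq_sym mulf_eq0 subr_eq0.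
by rewrite (negbTE y1) => /eqP ->; rewrite mulr0.
Qed.

(** The [2 ^ N] arcs from [1] to [-1] are at least as long as the chord. This
    bounds the mesh of the circle from below. *)
Lemma zeta1_far N : 4 <= 2 ^+ N.+1 * normc (zeta N.+1 1 - 1).
Proof.
have : 2 <= 2 ^+ N * normc (zeta N.+1 1 - 1).
  rewrite -[leLHS](_ : normc (zeta N.+1 1 ^+ (2 ^ N) - 1) = 2); last first.
    rewrite -zetaE zeta_half -opprD normcN -[1 + 1]/(2%:R : R[i]) -(rmorph_nat (real_complex R)) normcR.
    by rewrite ger0_norm.
  rewrite subrX1 normcM mulrC; apply: ler_wpM2r; first exact: normc_ge0.
  apply: (@le_trans _ _ (\sum_(i < 2 ^ N) 1)).
    by apply: le_normc_sum => k _; rewrite -zetaE normc_zeta.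
  by rewrite sumr_const card_ord natrX.
by rewrite exprS; lra.
Qed.

End RootsOfUnity.

Section Interpolant.
Local Open Scope ring_scope.
Context {K : numFieldType} (zeta : nat -> nat -> K).

Definition geom M (u : K) : K := \sum_(k < M) u ^+ k.

(** When [zeta] is the family of the [2 ^ N]-th roots of unity, this is the
    Lagrange interpolation polynomial of [h] at the points of modulus [rho].
    It is written as a discrete Cauchy integral in which the Cauchy kernel is
    replaced by a finite geometric sum, so that it is visibly a polynomial in
    [z] and linear in [h]. *)
Definition interpolant N (rho : K) (h : K -> K) z : K := (2 ^+ N)^-1 *
  \sum_(t < 2 ^ N) h (rho * zeta N t) * geom (2 ^ N) (z / (rho * zeta N t)).

End Interpolant.

Section Interpolation.
Local Open Scope ring_scope.
Local Open Scope complex_scope.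
Context {R : realType}.
Implicit Types (rho : R) (h : R[i] -> R[i]) (z : R[i]).

Local Notation interp N rho := (interpolant (@zeta R) N rho%:C).

Lemma interpolant_cst N rho a z : 0 < rho -> interp N rho (fun=> a) z = a.
Proof.
move=> rho0; rewrite /interpolant /geom -mulr_sumr mulrCA exchange_big /=.
have rz : rho%:C != 0 :> R[i] by rewrite fmorph_eq0 gt_eqF.
rewrite mulr_sumr (eq_bigr (fun k : 'I_(2 ^ N) => (z / rho%:C) ^+ k * (0%N == k)%:R)).
  have N0 : (0 < 2 ^ N)%N by rewrite expn_gt0.
  rewrite (bigD1 (Ordinal N0))//= expr0 mulr1 big1 ?addr0 ?mulr1// => k.
  by rewrite -val_eqE /= eq_sym => /negbTE ->; rewrite mulr0.
move=> k _; rewrite -(@zeta_mean R N) ?expn_gt0// mulrCA; congr (_ * _).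
rewrite mulr_sumr; apply: eq_bigr => t _.
by rewrite expr0 mul1r invfM mulrA exprMn exprVn.
Qed.

Lemma cdiff_shift h z : cdiff h -> cdiff (fun u => h (z + u)).
Proof.
move=> hd u0; have [A HA] := hd (z + u0); exists A => e /HA[d d0 Hd].
exists d => // u; have E : u - u0 = z + u - (z + u0) by ring.
by rewrite E => /Hd.
Qed.

(** Put [q = (z / rho) ^ 2 ^ N]. At each node [w], the geometric sum is [(1 -
    q) * w / (w - z)]. Hence the error is, up to the factor [(1 - q) / ((zeta
    1 - 1) * 2 ^ N)], which is bounded by [zeta1_far], the sum that
    [cauchy_star] shows to be small for the circle seen from [z]. *)
Lemma interpolant_normc_cvg rho h z e : cdiff h -> 0 < rho -> normc z <= rho / 2 -> 0 < e ->
  exists N0, forall N, (N0 <= N)%N -> normc (interp N rho h z - h z) < e.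
Proof.
move=> hd rho0 zr e0.
pose c t := rho%:C * cis t - z.
have L0 : 0 < 4 * pi * rho by rewrite !mulr_gt0 ?pi_gt0.
have nw t : normc (rho%:C * cis t) = rho.
  by rewrite normcM normcR normc_cis mulr1 gtr0_norm.
have c_lip t t' : normc (c t - c t') <= 4 * pi * rho * `|t - t'|.
  rewrite /c opprB addrA subrK -mulrBr normcM normcR gtr0_norm//.
  by have := cis_lip t t'; nra.
have c_bd t : normc (c t) <= 2 * rho.
  by apply: le_trans (le_normcB _ _) _; rewrite nw; lra.
have c_low t : rho / 2 <= normc (c t).
  have := le_normcD (c t) z; rewrite /c subrK nw; lra.
have c_per : c 1 = c 0 by rewrite /c cis1 cis0.
have r20 : 0 < rho / 2 by lra.
have [N0 HN0] := cauchy_star (cdiff_shift z hd) c_lip c_bd r20 c_low L0 c_per e0.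
exists N0.+1 => -[//|N] NN.
have {HN0} := HN0 N.+1 (ltnW NN); rewrite addr0.
set S := \sum_(0 <= k < _) _ => HS.
pose w t := rho%:C * zeta N.+1 t.
have w0 t : w t != 0 by rewrite mulf_neq0 ?zeta_neq0// fmorph_eq0 gt_eqF.
have wz t : w t - z != 0.
  by apply/eqP => E; have := c_low (mesh N.+1 t); rewrite /c -/(w t) E normc0; lra.
pose q := (z / rho%:C) ^+ (2 ^ N.+1).
have key : (zeta N.+1 1 - 1) * 2 ^+ N.+1 * (interp N.+1 rho h z - h z) = (1 - q) * S.
  rewrite -[X in _ * (_ - X)](interpolant_cst N.+1 (h z) z rho0) /interpolant /geom -mulrBr -sumrB.
  rewrite mulrA mulfK ?expf_neq0 ?pnatr_eq0// /S big_mkord !mulr_sumr.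
  apply: eq_bigr => t _; rewrite -/(w t) -mulrBl /vweight /c.
  have wS : rho%:C * cis (mesh N.+1 t.+1) = zeta N.+1 1 * w t.
    by rewrite -/(zeta N.+1 t.+1) zetaE exprS -zetaE /w mulrCA.
  rewrite wS -/(zeta N.+1 t) -/(w t) [z + _]addrC subrK.
  have G : (1 - z / w t) * \sum_(k < 2 ^ N.+1) (z / w t) ^+ k = 1 - q.
    have := subrX1 (z / w t) (2 ^ N.+1).
    have -> : (z / w t) ^+ (2 ^ N.+1) = q.
      rewrite /w /q !exprMn invfM exprMn [(zeta _ _)^-1 ^+ _]exprVn.
      by rewrite zetaE exprAC -zetaE zeta_order expr1n invr1 mulr1 exprVn.
    by move=> E; rewrite -[LHS]opprK -mulNr opprB -E opprB.
  have {}G : \sum_(k < 2 ^ N.+1) (z / w t) ^+ k = (1 - q) * w t / (w t - z).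
    by rewrite -G; field; rewrite w0 wz.
  by rewrite G; field; rewrite wz.
have q2 : normc (1 - q) <= 2.
  apply: le_trans (le_normcB _ _) _; rewrite normc1 -[leRHS]/(1 + 1) lerD2l.
  rewrite /q normcX exprn_ile1 ?normc_ge0// normcM normcV normcR gtr0_norm//.
  by rewrite ler_pdivrMr//; lra.
have far := @zeta1_far R N.
have : normc ((zeta N.+1 1 - 1) * 2 ^+ N.+1 * (interp N.+1 rho h z - h z)) <= 2 * normc S.
  by rewrite key normcM ler_wpM2r ?normc_ge0.
rewrite !normcM normcX -(rmorph_nat (real_complex R)) normcR ger0_norm// -[2%:R]/(2 : R).
rewrite [normc _ * 2 ^+ _]mulrC => H.
have := normc_ge0 (interp N.+1 rho h z - h z).
have H4 : 4 * normc (interp N.+1 rho h z - h z) <=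
  2 ^+ N.+1 * normc (zeta N.+1 1 - 1) * normc (interp N.+1 rho h z - h z).
  by rewrite ler_wpM2r ?normc_ge0.
lra.
Qed.

End Interpolation.

(** * Coordinates and multipliers of an unconditional basis *)

Section Basis.
Local Open Scope classical_set_scope.
Local Open Scope ring_scope.
Context {K : numFieldType} {V : normedModType K} (e : nat -> V).
Hypothesis he : schauder_basis e.

Lemma coef_expansion x : expansion e (fun j => coef e j x) x.
Proof.
have [a [ax _]] := he.1 x.
rewrite (_ : (fun j => coef e j x) = xget (fun=> 0) [set a | expansion e a x])//.
by case: xgetP => [a' _ //|/(_ a)].
Qed.

Lemma coef_unique a x j : expansion e a x -> coef e j x = a j.
Proof.
move=> ax; have [a' [_ U]] := he.1 x.
by rewrite -(U _ ax) (U _ (@coef_expansion x)).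
Qed.

Lemma expansion_lin k a a' x x' : expansion e a x -> expansion e a' x' ->
  expansion e (fun j => k * a j + a' j) (k *: x + x').
Proof.
move=> ax ax'; rewrite /expansion.
have -> : series (fun n => (k * a n + a' n) *: e n) =
    (fun n => k *: series (fun n => a n *: e n) n + series (fun n => a' n *: e n) n).
  apply/funext => n; rewrite /series /= scaler_sumr -big_split /=.
  by apply: eq_bigr => i _; rewrite scalerDl scalerA.
by apply: cvgD ax'; exact: cvgZr.
Qed.

Lemma coef_lin j k x y : coef e j (k *: x + y) = k * coef e j x + coef e j y.
Proof. exact: (coef_unique j (expansion_lin (@coef_expansion x) (@coef_expansion y))). Qed.

Lemma coefD j x y : coef e j (x + y) = coef e j x + coef e j y.
Proof. by have := coef_lin j 1 x y; rewrite scale1r mul1r. Qed.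

Lemma coef0 j : coef e j 0 = 0.
Proof. by apply: (addrI (coef e j 0)); rewrite -coefD !addr0. Qed.

Lemma coefZ j k x : coef e j (k *: x) = k * coef e j x.
Proof. by have := coef_lin j k x 0; rewrite !addr0 coef0 addr0. Qed.

Lemma coefB j x y : coef e j (x - y) = coef e j x - coef e j y.
Proof. by rewrite -scaleN1r coefD coefZ mulN1r. Qed.

Lemma coef_sum j I (r : seq I) (F : I -> V) :
  coef e j (\sum_(i <- r) F i) = \sum_(i <- r) coef e j (F i).
Proof. by elim/big_rec2 : _ => [|i x y _ <-]; [exact: coef0|exact: coefD]. Qed.

(** An expansion determines its sum because the norm topology is separated. *)
Lemma coef_inj x y : (forall j, coef e j x = coef e j y) -> x = y.
Proof.
move=> xy; apply: (@cvg_unique _ (@norm_hausdorff _ _) _ _ _ _ (@coef_expansion x)).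
by have := @coef_expansion y; rewrite /expansion; under eq_fun do rewrite -xy.
Qed.

Lemma coef_basis j k : coef e j (e k) = (j == k)%:R.
Proof.
apply: (@coef_unique (fun j => (j == k)%:R)); rewrite /expansion.
apply: cvg_near_cst; near=> n; have kn : (k < n)%N by near: n; exact: nbhs_infty_gt.
rewrite /series /= (bigD1_seq k)/= ?iota_uniq ?mem_index_iota//.
rewrite eqxx scale1r big1 ?addr0// => i /negbTE ->.
by rewrite scale0r.
Unshelve. all: by end_near. Qed.

End Basis.

Section Multipliers.
Local Open Scope classical_set_scope.
Local Open Scope ring_scope.
Context {K : numFieldType} {V : normedModType K} (e : nat -> V).
Hypothesis he : schauder_basis e.
Hypothesis hu : one_unconditional e.
Implicit Types (l : nat -> K) (x : V).

(** The multipliers for which 1-unconditionality gives operators of norm at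
    most one. *)
Definition disc_valued l := forall j, `|l j| <= 1.

Definition mult l x : V := xget 0 [set w | forall j, coef e j w = l j * coef e j x].

Lemma mult_subproof l x : disc_valued l ->
  (forall j, coef e j (mult l x) = l j * coef e j x) /\ `|mult l x| <= `|x|.
Proof.
move=> l1; have [w ew wx] := hu (@coef_expansion _ _ _ he x) l1.
have cw j : coef e j w = l j * coef e j x by exact: (coef_unique he _ ew).
suff -> : mult l x = w by [].
rewrite /mult; case: xgetP => [w' _ cw'|/(_ w)//].
by apply: (coef_inj he) => j; rewrite cw cw'.
Qed.

Lemma coef_mult l x j : disc_valued l ->
  coef e j (mult l x) = l j * coef e j x.
Proof. by move=> l1; have [->] := mult_subproof x l1. Qed.

Lemma norm_mult l x : disc_valued l -> `|mult l x| <= `|x|.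
Proof. by move=> l1; have [] := mult_subproof x l1. Qed.

Lemma multB l x y : disc_valued l -> mult l (x - y) = mult l x - mult l y.
Proof.
move=> l1; apply: (coef_inj he) => j.
by rewrite !(coefB he) !coef_mult// (coefB he) mulrBr.
Qed.

Lemma indic_le1 (P : pred nat) j : `|(P j)%:R : K| <= 1.
Proof. by rewrite normr_nat; case: (P j). Qed.

Definition trunc N x := \sum_(j < N) coef e j x *: e j.

Lemma truncE N x : trunc N x = mult (fun j => (j < N)%:R) x.
Proof.
apply: (coef_inj he) => j; rewrite coef_mult; last by move=> i; exact: indic_le1.
rewrite /trunc (coef_sum he).
rewrite (eq_bigr (fun i : 'I_N => coef e i x * (j == i)%:R)); last first.
  by move=> i _; rewrite (coefZ he) (coef_basis he).
have [jN|jN] := ltnP j N; last first.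
  rewrite mul0r big1// => i _; rewrite (gtn_eqF (leq_trans _ jN)) ?mulr0//.
rewrite mul1r (bigD1 (Ordinal jN))//= eqxx mulr1 big1 ?addr0// => i.
by rewrite -val_eqE /= eq_sym => /negbTE ->; rewrite mulr0.
Qed.

Lemma coef_trunc N x j : coef e j (trunc N x) = (j < N)%:R * coef e j x.
Proof. by rewrite truncE coef_mult// => i; exact: indic_le1. Qed.

Lemma trunc_cvg x : trunc ^~ x @ \oo --> x.
Proof.
have := @coef_expansion _ _ _ he x; rewrite /expansion.
suff -> : series (fun n => coef e n x *: e n) = trunc ^~ x by [].
by apply/funext => n; rewrite /series /trunc /= big_mkord.
Qed.

End Multipliers.

(** * The basis of a direct sum *)

Lemma lipschitz_continuous (K : numFieldType) (U W : normedModType K) (f : U -> W)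
  (C : K) : (0 < C)%R -> (forall x y, `|f x - f y| <= C * `|x - y|)%R -> continuous f.
Proof.
move=> C0 fC x; apply/cvgrPdist_lt => r r0; near=> y.
apply: le_lt_trans (fC _ _) _; rewrite -ltr_pdivlMl//; near: y.
by apply: cvgr_dist_lt; [exact: cvg_id|rewrite mulr_gt0// invr_gt0].
Unshelve. all: by end_near. Qed.

Section DirectSum.
Local Arguments bsum_in : simpl never.
Local Open Scope classical_set_scope.
Local Open Scope ring_scope.
Context {K : numFieldType} (E : solidSeqSpace K) (X : nat -> completeNormedModType K).
Implicit Types x y : bsum E X.

Lemma bsum_le x y : (forall j, `|x j| <= `|y j|) -> `|x| <= `|y|.
Proof.
move=> xy; rewrite !bsum_normE; apply: to_space_dom; first exact: bsumP.
by move=> j; rewrite /norm_seq !normr_id.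
Qed.

Lemma bsum_dom (z : forall j, X j) y : (forall j, `|z j| <= `|y j|) ->
  range (seq_of E) (norm_seq z).
Proof. by move=> zy; apply: range_dom (bsumP y) _ => j; rewrite /norm_seq !normr_id. Qed.

Let delta j : E := to_space E (fun i => (i == j)%:R).

Let deltaE j i : seq_of E (delta j) i = (i == j)%:R.
Proof.
by rewrite to_spaceK//; apply: c00_sub; exists j.+1 => k jk; rewrite gtn_eqF.
Qed.

Let delta_gt0 j : 0 < `|delta j|.
Proof.
rewrite normr_gt0; apply/eqP => d0; have := deltaE j j.
by rewrite d0 linear0 eqxx => /eqP; rewrite eq_sym oner_eq0.
Qed.

(** The sequence supported at [j] with entry [x j] is dominated by the norms
    of [x], and solidity compares their norms in [E]. *)
Lemma bsum_coord_le x j : `|x j| <= `|delta j|^-1 * `|x|.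
Proof.
rewrite ler_pdivlMl// mulrC -[leLHS]/(`|x j| * `|delta j|) -normr_id -normrZ.
rewrite bsum_normE -[Num.norm (x j) *: delta j]to_space_seq.
apply: to_space_dom; first exact: bsumP.
move=> i; rewrite linearZ /= -[_ i]/(`|x j| * seq_of E (delta j) i) deltaE.
by rewrite /norm_seq; case: eqP => [->|_]; rewrite ?mulr1// mulr0 normr0.
Qed.

Lemma bsum_coord_continuous j : continuous (fun x => x j).
Proof.
apply: (@lipschitz_continuous _ (bsum E X) (X j) _ `|delta j|^-1).
  by rewrite invr_gt0.
by move=> x y; exact: (bsum_coord_le (x - y) j).
Qed.

Lemma bsum_in_id j (v : X j) : bsum_in E v j = v.
Proof. by rewrite /bsum_in /= eqtype.dfwith_in. Qed.

Lemma bsum_in_out j i (v : X j) : j != i -> bsum_in E v i = 0.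
Proof. by move=> ji; rewrite /bsum_in /= eqtype.dfwith_out. Qed.

Lemma norm_bsum_in j (v : X j) : `|bsum_in E v| = `|v| * `|delta j|.
Proof.
rewrite -normr_id -normrZ bsum_normE -[Num.norm v *: delta j]to_space_seq.
congr (`|to_space _ _|); apply/funext => i.
rewrite linearZ -[RHS]/(`|v| * seq_of E (delta j) i) deltaE /norm_seq.
have [->|ij] := eqVneq i j; first by rewrite bsum_in_id mulr1.
by rewrite bsum_in_out 1?eq_sym// normr0 mulr0.
Qed.

Lemma bsum_in_lin j (k : K) (v w : X j) :
  bsum_in E (k *: v + w) = k *: bsum_in E v + bsum_in E w.
Proof.
apply: bsum_ext => i; rewrite -[RHS]/(k *: bsum_in E v i + bsum_in E w i).
have [->|ij] := eqVneq i j; first by rewrite !bsum_in_id.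
by rewrite !bsum_in_out 1?eq_sym// scaler0 addr0.
Qed.

Lemma bsum_in0 j : bsum_in E (0 : X j) = 0.
Proof. by apply/eqP; rewrite -normr_eq0 norm_bsum_in normr0 mul0r. Qed.

Lemma bsum_inB j (v w : X j) : bsum_in E (v - w) = bsum_in E v - bsum_in E w.
Proof. by have := bsum_in_lin (-1) w v; rewrite !scaleN1r addrC => ->; rewrite addrC. Qed.

Lemma bsum_in_sum j I (r : seq I) (F : I -> X j) :
  bsum_in E (\sum_(i <- r) F i) = \sum_(i <- r) bsum_in E (F i).
Proof.
elim/big_rec2 : _ => [|i x y _ <-]; first exact: bsum_in0.
by have := bsum_in_lin 1 (F i) y; rewrite !scale1r.
Qed.

(** If [s] in [c00] is close to the sequence of norms of [x], then beyond the
    support of [s] the difference of the two is that sequence itself; so the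
    tail of [x] is dominated by this difference. *)
Lemma bsum_trunc_close x (e : K) : 0 < e ->
  exists J, `|x - \sum_(j < J) bsum_in E (x j)| < e.
Proof.
move=> e0; pose s0 := to_space E (norm_seq x).
have [||s [xs [J sJ]]] := @c00_dense _ E (ball s0 e).
- by exists s0; exact: ballxx.
- exact: ball_open.
exists J; move: xs; rewrite -ball_normE /=; apply: le_lt_trans.
rewrite bsum_normE -[s0 - s]to_space_seq; apply: to_space_dom.
  by exists (s0 - s); rewrite ?to_space_seq.
move=> i; rewrite linearB -[X in _ <= `|X|]/(seq_of E s0 i - seq_of E s i).
rewrite to_spaceK; last exact: bsumP.
rewrite /norm_seq normr_id.
have -> : (x - \sum_(j < J) bsum_in E (x j)) i = if (i < J)%N then 0 else x i.
  have sumE (r : seq 'I_J) : (\sum_(j <- r) bsum_in E (x j)) i =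
      \sum_(j <- r) bsum_in E (x j) i by elim/big_rec2 : _ => // j ? ? _ <-.
  rewrite -[LHS]/(x i - (\sum_(j < J) bsum_in E (x j)) i) sumE.
  case: ltnP => iJ.
    rewrite (bigD1 (Ordinal iJ))// bsum_in_id big1 => [|j ji]; first by rewrite /= addr0 subrr.
    by rewrite bsum_in_out.
  rewrite big1 ?subr0// => j _; rewrite bsum_in_out// ltn_eqF//.
  exact: leq_trans (ltn_ord j) iJ.
case: ltnP => iJ; first by rewrite normr0.
by rewrite (sJ i iJ) subr0 normr_id.
Qed.

Context (e : forall j, nat -> X j) (he : forall j, one_unconditional_basis (e j)).
Context (sigma : nat -> nat * nat) (hsigma : bijective sigma).

Definition sum_basis n : bsum E X := bsum_in E (e (sigma n).1 (sigma n).2).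
Local Notation b := sum_basis.

Definition sum_coef n x : K := coef (e (sigma n).1) (sigma n).2 (x (sigma n).1).

Let sb j := (he j).1.
Let ub j := (he j).2.

Lemma sum_coef_lin n k x y : sum_coef n (k *: x + y) = k * sum_coef n x + sum_coef n y.
Proof. exact: (coef_lin (sb _)). Qed.

Lemma sum_coef0 n : sum_coef n 0 = 0.
Proof. exact: (coef0 (sb _)). Qed.

Lemma sum_coef_sum n I (r : seq I) (F : I -> bsum E X) :
  sum_coef n (\sum_(i <- r) F i) = \sum_(i <- r) sum_coef n (F i).
Proof.
elim/big_rec2 : _ => [|i x y _ <-]; first exact: sum_coef0.
by have := sum_coef_lin n 1 (F i) y; rewrite scale1r mul1r.
Qed.

Lemma sum_coefZ n k x : sum_coef n (k *: x) = k * sum_coef n x.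
Proof. by have := sum_coef_lin n k x 0; rewrite !addr0 sum_coef0 addr0. Qed.

Lemma sum_coef_continuous n : continuous (sum_coef n : bsum E X -> K^o).
Proof.
move=> x; apply: (@continuous_comp _ _ _ (fun x : bsum E X => x (sigma n).1)).
  exact: bsum_coord_continuous.
exact: (sb (sigma n).1).2.
Qed.

Lemma sum_coef_basis n m : sum_coef n (b m) = (n == m)%:R.
Proof.
rewrite -(inj_eq (bij_inj hsigma)) /sum_coef /b.
case: (sigma n) (sigma m) => [j k] [j' k'] /=.
rewrite xpair_eqE; have [jj|jj] := eqVneq j j'.
  by case: j' / jj; rewrite eqtype.dfwith_in (coef_basis (sb j)).
by rewrite eqtype.dfwith_out 1?eq_sym// (coef0 (sb j)).
Qed.

Lemma sum_coef_inj x y : (forall n, sum_coef n x = sum_coef n y) -> x = y.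
Proof.
have [tau _ tauK] := hsigma.
move=> xy; apply: bsum_ext => j; apply: (coef_inj (sb j)) => k.
by have := xy (tau (j, k)); rewrite /sum_coef tauK.
Qed.

(** Acting by a multiplier in each block decreases the norm of each
    coordinate, so the result stays in the sum and is dominated by [x]. *)
Lemma sum_multiplier x (l : nat -> K) : (forall n, `|l n| <= 1) ->
  exists2 w : bsum E X, `|w| <= `|x| & forall n, sum_coef n w = l n * sum_coef n x.
Proof.
move=> l1; have [tau tauK sigmaK] := hsigma.
pose z j := mult (e j) (fun k => l (tau (j, k))) (x j).
have zx j : `|z j| <= `|x j| by apply: (norm_mult (sb j) (@ub j)) => k; exact: l1.
exists (BSum (bsum_dom zx)); first exact: bsum_le.
move=> n; rewrite /sum_coef /= (coef_mult (sb _) (@ub _)); last by move=> k; exact: l1.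
by rewrite -surjective_pairing tauK.
Qed.

Let fin y := exists N, forall n, (N <= n)%N -> sum_coef n y = 0.

Let fin_sum I (r : seq I) (F : I -> bsum E X) : (forall i, fin (F i)) ->
  fin (\sum_(i <- r) F i).
Proof.
move=> Ff; elim: r => [|i r [N HN]].
  by rewrite big_nil; exists 0%N => n _; exact: sum_coef0.
have [M HM] := Ff i; exists (maxn M N) => n; rewrite geq_max => /andP[Mn Nn].
rewrite big_cons -[X in sum_coef n (X + _)]scale1r sum_coef_lin.
by rewrite HM// HN// mulr0 addr0.
Qed.

Let fin_basis n k : fin (k *: b n).
Proof.
exists n.+1 => m nm; rewrite sum_coefZ sum_coef_basis.
by rewrite gtn_eqF// mulr0.
Qed.

(** The truncation of [x] to finitely many blocks is close to [x]; in each of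
    these blocks a partial sum of the expansion is close to the coordinate. *)
Let fin_dense x (r : K) : 0 < r -> exists2 y, fin y & `|x - y| < r.
Proof.
move=> r0; have [tau tauK sigmaK] := hsigma.
have [J HJ] := bsum_trunc_close x (divr_gt0 r0 (ltr0n _ 2)).
have /choice[y Hy] (j : 'I_J) : exists y, fin y /\
    `|bsum_in E (x j) - y| <= r / 2 / J%:R.
  have J0 : 0 < J%:R :> K by rewrite ltr0n; case: (J) j => // -[].
  have := trunc_cvg (sb j) (x := x j).
  have q0 : 0 < r / 2 / J%:R / `|delta j| by rewrite !divr_gt0.
  move=> /cvgrPdist_lt /(_ _ q0) [N _ /(_ N (leqnn N)) HN].
  exists (bsum_in E (trunc (e j) N (x j))); split.
    rewrite /trunc bsum_in_sum; apply: fin_sum => k.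
    have -> : bsum_in E (coef (e j) k (x j) *: e j k) =
        coef (e j) k (x j) *: b (tau ((j : nat), (k : nat))).
      rewrite /b sigmaK /=.
      by have := bsum_in_lin (coef (e j) k (x j)) (e j k) 0; rewrite bsum_in0 !addr0.
    exact: fin_basis.
  by rewrite -bsum_inB norm_bsum_in -ler_pdivlMr// ltW.
exists (\sum_(j < J) y j); first by apply: fin_sum => j; case: (Hy j).
rewrite -(subrK (\sum_(j < J) bsum_in E (x j)) x) -addrA -sumrB.
apply: le_lt_trans (ler_normD _ _) _; rewrite (splitr r).
apply: ltr_leD => //; apply: le_trans (ler_norm_sum _ _ _) _.
apply: (@le_trans _ _ (\sum_(j < J) (r / 2 / J%:R))).
  by apply: ler_sum => j _; case: (Hy j).
rewrite sumr_const card_ord -[leLHS]mulr_natr.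
case: (J) => [|n]; first by rewrite mulr0 divr_ge0// ltW.
by rewrite divfK// pnatr_eq0.
Qed.

(** Let [y] have finitely many coordinates and lie close to [x]. A partial sum
    that exhausts the coordinates of [y] differs from [x] by the image of [x -
    y] under the multiplier that kills the coordinates already summed. *)
Lemma sum_expansion x : expansion b (fun n => sum_coef n x) x.
Proof.
apply/cvgrPdist_lt => r r0.
have [y [N HN] xy] := fin_dense x r0.
exists N => // n /= Nn.
have [|w wx Hw] := @sum_multiplier (x - y) (fun m => (n <= m)%:R).
  by move=> m; rewrite normr_nat; case: leq.
suff -> : x - series (fun n => sum_coef n x *: b n) n = w by exact: le_lt_trans wx xy.
apply: sum_coef_inj => m; rewrite Hw.
have cB u v : sum_coef m (u - v) = sum_coef m u - sum_coef m v.
  by rewrite addrC -scaleN1r sum_coef_lin mulN1r addrC.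
rewrite !cB /series /= big_mkord sum_coef_sum.
rewrite (eq_bigr (fun i : 'I_n => sum_coef i x * (m == i)%:R)); last first.
  by move=> i _; rewrite sum_coefZ sum_coef_basis.
case: leqP => nm.
  rewrite big1 ?subr0 => [|i _]; last by rewrite gtn_eqF ?mulr0// (leq_trans _ nm).
  by rewrite mul1r HN ?subr0// (leq_trans Nn).
rewrite (bigD1 (Ordinal nm))//= eqxx mulr1 big1 ?addr0 ?subrr ?mul0r// => i.
by rewrite -val_eqE /= eq_sym => /negbTE ->; rewrite mulr0.
Qed.

(** The coordinates are continuous, and on the partial sums they are
    eventually constant. *)
Lemma sum_expansion_unique a x n : expansion b a x -> sum_coef n x = a n.
Proof.
move=> ax.
have h1 : (fun N => sum_coef n (series (fun m => a m *: b m) N) : K^o) @ \oo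
    --> (sum_coef n x : K^o).
  exact: (continuous_cvg _ (@sum_coef_continuous n x) ax).
have h2 : (fun N => sum_coef n (series (fun m => a m *: b m) N) : K^o) @ \oo
    --> (a n : K^o).
  apply: cvg_near_cst; exists n.+1 => // N /= nN.
  rewrite /series /= big_mkord sum_coef_sum (bigD1 (Ordinal nN))//=.
  rewrite sum_coefZ sum_coef_basis eqxx mulr1 big1 ?addr0// => i.
  rewrite -val_eqE /= eq_sym sum_coefZ sum_coef_basis => /negbTE ->.
  by rewrite mulr0.
exact: (cvg_unique _ h1 h2).
Qed.

Lemma sum_basis_unconditional : one_unconditional_basis b.
Proof.
have sbb : schauder_basis b.
  split=> [x|n].
    exists (fun n => sum_coef n x); split; first exact: sum_expansion.
    by move=> a ax; apply/funext => n; exact: sum_expansion_unique.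
  rewrite (_ : coef b n = sum_coef n); first exact: sum_coef_continuous.
  apply/funext => x; rewrite /coef; case: xgetP => [a _ ax|/(_ (fun n => sum_coef n x))].
    by rewrite (sum_expansion_unique n ax).
  by case; exact: sum_expansion.
split=> // a v l av l1.
have [w wv Hw] := sum_multiplier v l1.
exists w => //; rewrite (_ : (fun j => _) = fun n => sum_coef n w); first exact: sum_expansion.
by apply/funext => n; rewrite Hw (sum_expansion_unique n av).
Qed.

End DirectSum.

(** * The compact-open topology and a basis criterion *)

Section CompactOpen.
Local Open Scope classical_set_scope.
Local Open Scope ring_scope.
Context {K : numFieldType} {V : normedModType K}.
Implicit Types f g : holo V.

Lemma holo_nbhs f (C : set V) (r : K) : compact C -> 0 < r ->
  nbhs f [set g : holo V | forall x, C x -> `|f x - g x| < r].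
Proof.
move=> cC r0; have := @initial_continuous _ _ (@holo_val K V : holo V -> {family compact, V -> K^o}) f.
move=> /(_ [set g | forall x, C x -> `|(f x : K^o) - g x| < r]); apply.
apply: (@fam_nbhs _ _ compact C [set xy : K^o * K^o | `|xy.1 - xy.2| < r] (f : {family compact, V -> K^o})) => //.
by rewrite -(@entourage_ballE K K^o); exists r => // -[x y].
Qed.

Lemma holo_cvgP (F : set_system (holo V)) f : Filter F -> F --> f <->
  forall (C : set V) (r : K), compact C -> 0 < r ->
    F [set g : holo V | forall x, C x -> `|f x - g x| < r].
Proof.
move=> FF; split=> [Ff C r cC r0|H].
  exact: Ff (holo_nbhs f cC r0).
have : {family compact, (@holo_val K V @ F) --> (f : V -> K^o)}.
  apply/fam_cvgP => C cC U /uniform_nbhs[E [+ EU]].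
  rewrite -(@entourage_ballE K K^o) => -[r /= r0 rE].
  apply: filterS (H C r cC r0) => g fg; apply: EU => x Cx.
  by apply: rE => /=; rewrite -ball_normE; exact: fg.
move=> h U [_ [[B Bop <-] Bf BU]].
by apply: filterS BU _; apply: h; apply: open_nbhs_nbhs.
Qed.

End CompactOpen.

Section ComplexScalars.
Local Open Scope classical_set_scope.
Local Open Scope ring_scope.
Local Open Scope complex_scope.
Context {R : realType}.
Local Notation K := R[i].

Lemma complex_gt0_real (r : K) : 0 < r -> exists2 q : R, 0 < q & r = q%:C.
Proof.
case: r => a b; rewrite ltcE /= => /andP[/eqP -> a0].
by exists a.
Qed.

Lemma complex_archi (r : K) : r \is Num.real -> exists n : nat, r < n%:R.
Proof.
case/complex_realP => q ->; exists (Num.truncn q).+1.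
rewrite -(rmorph_nat (real_complex R)) ltcR; exact: truncnS_gt.
Qed.

Lemma complex_small (r : K) : 0 < r -> exists n : nat, n.+1%:R^-1 < r.
Proof.
move=> r0; have [|n Hn] := @complex_archi r^-1; first by rewrite gtr0_real ?invr_gt0.
exists n; rewrite -[r]invrK ltf_pV2 ?posrE ?invr_gt0 ?ltr0n//.
by apply: lt_le_trans Hn _; rewrite ler_nat.
Qed.

Let real_complete (u : nat -> R) :
  (forall e, 0 < e -> exists N, forall n, (N <= n)%N -> `|u N - u n| < e) ->
  exists l : R, u @ \oo --> l.
Proof.
move=> H; apply/cvg_ex; apply: cauchy_cvg; apply: cauchy_exP => e /H[N HN].
by exists (u N), N => // n /= /HN; rewrite -ball_normE.
Qed.

Lemma complex_complete (u : nat -> K) :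
  (forall e : K, 0 < e -> exists N, forall n, (N <= n)%N -> `|u N - u n| < e) ->
  exists l, forall e : K, 0 < e -> exists N, forall n, (N <= n)%N -> `|l - u n| < e.
Proof.
move=> H.
have normReIm (z : K) : `|complex.Re z| <= normc z /\ `|complex.Im z| <= normc z.
  by case: z => a b /=; rewrite -!sqrtr_sqr !ler_wsqrtr// ?lerDl ?lerDr sqr_ge0.
have [e e0|a Ha] := @real_complete (fun n => complex.Re (u n)).
  have [|N HN] := H e%:C; first by rewrite ltcR.
  exists N => n /HN; rewrite normCE ltcR; apply: le_lt_trans => /=.
  by have [] := normReIm (u N - u n); case: (u N) (u n) => [? ?] [? ?].
have [e e0|b Hb] := @real_complete (fun n => complex.Im (u n)).
  have [|N HN] := H e%:C; first by rewrite ltcR.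
  exists N => n /HN; rewrite normCE ltcR; apply: le_lt_trans => /=.
  by have [] := normReIm (u N - u n); case: (u N) (u n) => [? ?] [? ?].
exists (a +i* b) => _ /complex_gt0_real[e e0 ->].
have e20 : 0 < e / 2 by rewrite divr_gt0.
move/cvgrPdist_lt : Ha => /(_ _ e20)[N1 _ H1].
move/cvgrPdist_lt : Hb => /(_ _ e20)[N2 _ H2].
exists (maxn N1 N2) => n; rewrite geq_max => /andP[/H1 /= h1 /H2 /= h2].
rewrite normCE ltcR; apply: le_lt_trans (normc_le_ReIm _) _.
by case: (u n) h1 h2 => c d /=; lra.
Qed.

(** Local bounds can be taken among the natural numbers, since the complex
    moduli are archimedean; a bound valid on all of [C] is then a statement
    about all large integers. *)
Lemma compact_bounded_fun (T : topologicalType) (g : T -> K^o) (C : set T) :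
  continuous g -> compact C -> exists2 B : K, 0 < B & forall x, C x -> `|g x| <= B.
Proof.
move=> cg /compact_near_coveringP cC.
have [|N _ HN] := @cC nat \oo (fun n x => `|g x| <= n%:R) _.
  move=> x Cx; have [|n Hn] := @complex_archi (`|g x| + 1).
    by rewrite realD ?normr_real ?real1.
  near=> y i => /=.
  apply: (@le_trans _ _ (`|g x| + 1)); last first.
    apply: (le_trans (ltW Hn)); rewrite ler_nat; near: i; exact: nbhs_infty_ge.
  rewrite -lerBlDl; apply: le_trans (lerB_dist _ _) _; rewrite distrC ltW//.
  by near: y; move/cvgrPdist_lt : (cg x); apply.
exists N.+1%:R => // x Cx; apply: le_trans (HN N (leqnn N) x Cx) _.
by rewrite ler_nat.
Unshelve. all: by end_near. Qed.

End ComplexScalars.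

Section Criterion.
Local Open Scope classical_set_scope.
Local Open Scope ring_scope.
Context {R : realType}.
Local Notation K := R[i].
Context {V : normedModType K} (m : nat -> holo V).
Implicit Types (a : nat -> K) (r : nat) (f g : holo V) (C : set V).

Definition psum a r (x : V) : K := \sum_(k < r) a k * m k x.

Definition supported a r := forall k, (r <= k)%N -> a k = 0.

Lemma psumS a r x : psum a r.+1 x = psum a r x + a r * m r x.
Proof. by rewrite /psum big_ord_recr. Qed.

Lemma psum_supported a r n x : supported a r -> (r <= n)%N -> psum a n x = psum a r x.
Proof.
move=> ar; elim: n => [|n ih]; first by rewrite leqn0 => /eqP ->.
rewrite leq_eqVlt => /predU1P[->//|rn].
by rewrite psumS (ar n)// mul0r addr0 ih.
Qed.

Lemma psumB a a' r x : psum (fun k => a k - a' k) r x = psum a r x - psum a' r x.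
Proof. by rewrite /psum -sumrB; apply: eq_bigr => k _; rewrite mulrBl. Qed.

Lemma psumE a n x : series (fun k => a k *: m k : holo V) n x = psum a n x.
Proof.
rewrite /series /= /psum big_mkord.
by elim/big_rec2 : _ => // k y g _ <-.
Qed.

Lemma holo_continuous f : continuous (f : V -> K^o).
Proof.
by move=> x; apply: differentiable_continuous; case: f => f /= /asboolP; exact.
Qed.

Hypothesis partial_sum_bound : forall C, compact C ->
  exists C' (M : K), [/\ compact C', 0 < M & forall a q r B, (q <= r)%N ->
    (forall x, C' x -> `|psum a r x| <= B) ->
    forall x, C x -> `|psum a q x| <= M * B].
Hypothesis m_neq0 : forall k, exists x, m k x != 0.
Hypothesis psum_dense : forall f C (e : K), compact C -> 0 < e ->
  exists a r, supported a r /\ forall x, C x -> `|f x - psum a r x| <= e.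

(** A single term is the difference of two consecutive partial sums, evaluated
    at a point where its monomial does not vanish. *)
Lemma coef_bound k : exists C (M : K), [/\ compact C, 0 < M &
  forall a r B, supported a r -> (forall x, C x -> `|psum a r x| <= B) ->
    `|a k| <= M * B].
Proof.
have [x0 mx0] := m_neq0 k.
have [C [M [cC M0 H]]] := partial_sum_bound (@compact_set1 _ x0).
have n0 : 0 < `|m k x0| by rewrite normr_gt0.
exists C, (2 * M / `|m k x0|); split=> //; first by rewrite divr_gt0// mulr_gt0.
move=> a r B ar HB; rewrite mulrAC ler_pdivlMr// -normrM.
have HB' x : C x -> `|psum a (maxn r k.+1) x| <= B.
  by move=> Cx; rewrite (psum_supported _ ar) ?leq_maxl//; exact: HB.
have -> : a k * m k x0 = psum a k.+1 x0 - psum a k x0.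
  by rewrite psumS addrAC subrr add0r.
have kr : (k.+1 <= maxn r k.+1)%N by rewrite leq_maxr.
rewrite -mulrA mulr_natl mulr2n; apply: le_trans (ler_normB _ _) _.
by apply: lerD; apply: H HB' _ _ => //; exact: ltnW.
Qed.

(** The [k]-th coefficient of a polynomial is continuous for the compact-open
    topology, so it extends to every function in the closure. The extension
    [c] is characterised by the final estimate. *)
Lemma approx_coef_exists k : exists C (M : K), [/\ compact C, 0 < M &
  forall f, exists c : K, forall a r (e : K), supported a r -> 0 < e ->
    (forall x, C x -> `|f x - psum a r x| <= e) -> `|c - a k| <= M * e].
Proof.
have [C [M [cC M0 H]]] := coef_bound k.
exists C, (2 * M); split=> //; first exact: mulr_gt0.
move=> f.
have diff a a' r r' e e' : supported a r -> supported a' r' ->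
    (forall x, C x -> `|f x - psum a r x| <= e) ->
    (forall x, C x -> `|f x - psum a' r' x| <= e') -> `|a k - a' k| <= M * (e + e').
  move=> ar ar' fa fa'.
  apply: (H (fun k => a k - a' k) (maxn r r')).
    by move=> i; rewrite geq_max => /andP[? ?]; rewrite ar// ar'// subrr.
  move=> x Cx; rewrite psumB (psum_supported _ ar) ?leq_maxl//.
  rewrite (psum_supported _ ar') ?leq_maxr// -[X in `|X - _|](subrK (f x)) -addrA.
  apply: le_trans (ler_normD _ _) _; apply: lerD; last exact: fa'.
  by rewrite distrC; exact: fa.
have /choice[b Hb] (n : nat) : exists ar : (nat -> K) * nat, supported ar.1 ar.2 /\
    forall x, C x -> `|f x - psum ar.1 ar.2 x| <= n.+1%:R^-1.
  have [|a [r ar]] := psum_dense f (e := n.+1%:R^-1) cC; first by rewrite invr_gt0.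
  by exists (a, r).
have [e e0|c Hc] := @complex_complete R (fun n => (b n).1 k).
  have [|N HN] := @complex_small R (e / M / 2); first by rewrite !divr_gt0.
  exists N => n Nn; apply: le_lt_trans (diff _ _ _ _ _ _ (Hb N).1 (Hb n).1 (Hb N).2 (Hb n).2) _.
  rewrite -ltr_pdivlMl// [M^-1 * e]mulrC (splitr (e / M)).
  apply: ltrD => //; apply: le_lt_trans HN.
  by rewrite lef_pV2 ?posrE ?ltr0n// ler_nat ltnS.
exists c => a r e ar e0 fa.
have [|N1 H1] := Hc (M * e / 2); first by rewrite !mulr_gt0 ?invr_gt0.
have [|N2 H2] := @complex_small R (e / 2); first by rewrite divr_gt0.
pose N := maxn N1 N2.
have h1 := H1 N (leq_maxl _ _).
have h2 : N.+1%:R^-1 <= e / 2 :> K.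
  apply: le_trans (ltW H2); rewrite lef_pV2 ?posrE ?ltr0n// ler_nat ltnS.
  exact: leq_maxr.
have h3 := diff _ _ _ _ _ _ (Hb N).1 ar (Hb N).2 fa.
rewrite -(subrK ((b N).1 k) c) -addrA; apply: le_trans (ler_normD _ _) _.
have -> : 2 * M * e = M * e / 2 + M * (e / 2 + e).
  rewrite mulrDr mulrA addrA -splitr -mulrA mulr_natl mulr2n//.
apply: lerD; first exact: ltW.
by apply: le_trans h3 _; rewrite ler_pM2l// lerD2r.
Qed.

Lemma compact_bigcup n (C : nat -> set V) (C0 : set V) :
  (forall k, compact (C k)) -> compact C0 ->
  exists D, [/\ compact D, C0 `<=` D & forall k, (k < n)%N -> C k `<=` D].
Proof.
move=> cC cC0; elim: n => [|n [D [cD C0D CD]]]; first by exists C0; split=> //; exact: subset_refl.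
exists (D `|` C n); split; first exact: compactU.
  by move=> x /C0D; left.
move=> k; rewrite ltnS leq_eqVlt => /predU1P[->|kn] x Cx; first by right.
by left; exact: CD Cx.
Qed.

(** Grunblum's criterion. The [n]-th partial sum of [f] is approximated by the
    one of a polynomial very close to [f] (with an error that may depend on
    [n]), and the latter is compared with a fixed polynomial [psum a r]
    through the uniform bound of the partial sums; for [n] beyond [r] that
    fixed polynomial is its own partial sum. *)
Theorem schauder_criterion : schauder_basis m.
Proof.
have /choice[D0 HD0] := approx_coef_exists.
have /choice[M HM] := HD0.
pose D k := D0 k; have cD k : compact (D k) by case: (HM k).
have M0 k : 0 < M k by case: (HM k).
have /choice[c Hc] : forall k, exists c : holo V -> K, forall f a r e,
    supported a r -> 0 < e -> (forall x, D k x -> `|f x - psum a r x| <= e) ->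
    `|c f - a k| <= M k * e.
  by move=> k; have [_ _ /choice[c Hc]] := HM k; exists c.
have unique f a k : expansion m a f -> c k f = a k.
  move=> /holo_cvgP af; apply/eqP; rewrite -subr_eq0 -normr_eq0.
  apply/negPn/negP => n0.
  have q0 : 0 < `|c k f - a k| by rewrite lt_def n0 normr_ge0.
  have e0 : 0 < `|c k f - a k| / M k / 2 by rewrite !divr_gt0.
  have [N _ HN] := af _ _ (cD k) e0.
  pose n := maxn N k.+1.
  have := Hc k f (fun i => if (i < n)%N then a i else 0) n _ _ e0.
  rewrite leq_maxr => H; suff : `|c k f - a k| <= `|c k f - a k| / 2.
    by rewrite ler_pdivlMr// mulr_natr mulr2n gerDl => /(lt_le_trans q0); rewrite ltxx.
  have -> : `|c k f - a k| / 2 = M k * (`|c k f - a k| / M k / 2).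
    by rewrite mulrA [M k * _]mulrC divfK// gt_eqF.
  apply: H; first by move=> i; rewrite leqNgt => /negbTE ->.
  move=> x Dx; have := HN n (leq_maxl _ _) x Dx; rewrite psumE => /ltW.
  congr (`|_ - _| <= _); apply: eq_bigr => i _.
  by rewrite ltn_ord.
have converges f : expansion m (fun k => c k f) f.
  apply/holo_cvgP => C e cC e0.
  have [C' [M1 [cC' M10 HC']]] := partial_sum_bound cC.
  have M3 : 0 < 4 + 2 * M1 by rewrite addr_gt0 ?mulr_gt0.
  pose d := e / (4 + 2 * M1).
  have d0 : 0 < d by rewrite divr_gt0.
  have [a [r [ar fa]]] := psum_dense f (compactU cC cC') d0.
  exists r => // n /= rn x Cx; rewrite psumE.
  have /choice[B HB] : forall k, exists B : K, 0 < B /\ forall x, C x -> `|m k x| <= B.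
    by move=> k; have [B B0 HB] := compact_bounded_fun (@holo_continuous (m k)) cC; exists B.
  have [D' [cD' C'D' DD']] := compact_bigcup n cD cC'.
  (* the coefficients below [n] of [f] and of a polynomial [d / s]-close to it
     give partial sums that are [d]-close on [C] *)
  pose s := 1 + \sum_(k < n) M k * B k.
  have s0 : 0 < s.
    rewrite ltr_wpDr// sumr_ge0// => k _.
    by rewrite mulr_ge0// ltW//; case: (HB k).
  have s1 : 1 <= s.
    by rewrite lerDl sumr_ge0// => k _; rewrite mulr_ge0// ltW//; case: (HB k).
  have d'0 : 0 < d / s by rewrite divr_gt0.
  have d'd : d / s <= d by rewrite ler_pdivrMr// ler_pMr.
  have [a' [r' [ar' fa']]] := psum_dense f cD' d'0.
  have h1 : `|psum (fun k => c k f) n x - psum a' n x| <= d.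
    rewrite -psumB; apply: le_trans (ler_norm_sum _ _ _) _.
    apply: (@le_trans _ _ (\sum_(k < n) (M k * B k * (d / s)))).
      apply: ler_sum => k _; rewrite normrM mulrAC; apply: ler_pM => //.
        by apply: Hc ar' d'0 _ => y Dy; apply: fa'; apply: DD' Dy.
      by case: (HB k) => _; apply.
    rewrite -mulr_suml mulrC -mulrA -[leRHS]mulr1 ler_pM2l// ler_pdivrMl// mulr1.
    by rewrite /s lerDr.
  have h2 : `|psum a' n x - psum a n x| <= M1 * (d + d).
    rewrite -psumB; apply: (HC' _ n (maxn n r')); rewrite ?leq_maxl// => y Cy.
    rewrite psumB (psum_supported _ ar') ?leq_maxr//.
    rewrite (psum_supported _ ar) ?(leq_trans rn) ?leq_maxl//.
    rewrite -[X in `|X - _|](subrK (f y)) -addrA.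
    apply: le_trans (ler_normD _ _) _; apply: lerD; last by apply: fa; right.
    rewrite distrC; apply: le_trans (fa' y _) d'd; exact: C'D'.
  have h3 : `|f x - psum a n x| <= d.
    by rewrite (psum_supported _ ar rn); apply: fa; left.
  have -> : f x - psum (fun k => c k f) n x = (f x - psum a n x) -
      ((psum (fun k => c k f) n x - psum a' n x) + (psum a' n x - psum a n x)).
    by rewrite subrKA opprB addrA subrK.
  apply: le_lt_trans (ler_normB _ _) _.
  apply: (@le_lt_trans _ _ (d + (d + M1 * (d + d)))).
    by apply: lerD => //; apply: le_trans (ler_normD _ _) _; apply: lerD.
  have -> : e = d * (4 + 2 * M1) by rewrite /d divfK// gt_eqF.
  rewrite -subr_gt0; have -> : d * (4 + 2 * M1) - (d + (d + M1 * (d + d))) = 2 * d.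
    by ring.
  by rewrite mulr_gt0.
split=> [f|k].
  exists (fun k => c k f); split=> // a af.
  by apply/funext => k; exact: unique.
have -> : coef m k = c k.
  apply/funext => f; rewrite /coef; case: xgetP => [a _ fa|/(_ (fun k => c k f))].
    by rewrite -(unique f a).
  by case; exact: converges.
move=> f; have FF : Filter (nbhs f) by exact: nbhs_filter.
apply/(@cvgrPdist_lt _ K^o _ _ FF (c k) (c k f)) => e e0.
pose d := e / (4 * M k).
have d0 : 0 < d by rewrite divr_gt0// mulr_gt0.
apply: filterS (holo_nbhs f (cD k) d0) => g fg.
have [a [r [ar ga]]] := psum_dense g (cD k) d0.
have h1 : `|c k g - a k| <= M k * d by exact: Hc ar d0 ga.
have h2 : `|c k f - a k| <= M k * (d + d).
  apply: Hc ar _ _ => [|x Dx]; first by rewrite addr_gt0.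
  rewrite -(subrK (g x) (f x)) -addrA; apply: le_trans (ler_normD _ _) _.
  by apply: lerD; [exact/ltW/fg|exact: ga].
rewrite -(subrK (a k) (c k f)) -addrA; apply: le_lt_trans (ler_normD _ _) _.
rewrite [Num.norm (a k - _)]distrC; apply: le_lt_trans (lerD h2 h1) _.
have -> : e = d * (4 * M k) by rewrite /d divfK// gt_eqF// mulr_gt0.
rewrite -subr_gt0; have -> : d * (4 * M k) - (M k * (d + d) + M k * d) = M k * d.
  by ring.
by rewrite mulr_gt0.
Qed.

End Criterion.

(** * Solid hulls of compact sets *)

Section Disc.
Local Open Scope classical_set_scope.
Local Open Scope ring_scope.
Local Open Scope complex_scope.
Context {R : realType}.
Local Notation K := R[i].

(** The disc is a closed subset of the image of a square. *)
Lemma compact_disc : compact [set z : K^o | `|z| <= 1].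
Proof.
pose phi (p : R * R) : K^o := p.1 +i* p.2.
have cphi : continuous phi.
  move=> p; apply/cvgrPdist_lt => _ /complex_gt0_real[e e0 ->].
  have e20 : 0 < e / 2 by rewrite divr_gt0.
  near=> q; rewrite normCE ltcR; apply: le_lt_trans (normc_le_ReIm _) _.
  rewrite /phi /= (splitr e); apply: ltrD; near: q.
    have H : (fun q : R * R => q.1) @ p --> p.1 by exact: cvg_fst.
    by have /cvgrPdist_lt/(_ _ e20) := H.
  have H : (fun q : R * R => q.2) @ p --> p.2 by exact: cvg_snd.
  by have /cvgrPdist_lt/(_ _ e20) := H.
have cbox : compact (phi @` (`[-1, 1] `*` `[-1, 1])).
  apply: continuous_compact; first exact: continuous_subspaceT.
  by apply: compact_setX; exact: segment_compact.
apply: subclosed_compact cbox _.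
  move=> z zD /=; rewrite normCE -[1]/(1%:C) lecR.
  apply/ler_addgt0Pr => e e0.
  have [|y [/= y1 zy]] := zD (ball z e%:C).
    by apply: nbhsx_ballx; rewrite ltcR.
  move: zy y1; rewrite -ball_normE /= !normCE -[1]/(1%:C) lecR ltcR => zy y1.
  rewrite -(subrK y z) addrC; apply: le_trans (le_normcD _ _) _.
  by apply: lerD => //; exact: ltW.
move=> -[a b] /=; rewrite normCE -[1]/(1%:C) lecR => ab.
exists (a, b) => //; rewrite /= !in_itv /= -!ler_norml.
split; apply: le_trans ab => /=.
  by rewrite -sqrtr_sqr ler_wsqrtr// lerDl sqr_ge0.
by rewrite -sqrtr_sqr ler_wsqrtr// lerDr sqr_ge0.
Unshelve. all: by end_near. Qed.

End Disc.

Section SolidHull.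
Local Open Scope classical_set_scope.
Local Open Scope ring_scope.
Context {K : numFieldType} {V : normedModType K} (e : nat -> V).
Hypothesis he : schauder_basis e.
Hypothesis hu : one_unconditional e.
Implicit Types (l : nat -> K) (x : V) (C : set V).

(** The smallest set containing [C] and stable under coordinatewise
    multiplication by elements of the closed unit disc. *)
Definition solid_hull C : set V :=
  [set mult e xl.2 xl.1 | xl in [set xl : V * (nat -> K) | C xl.1 /\ disc_valued xl.2]].

Lemma solid_hull_mult C l x : disc_valued l -> solid_hull C x -> solid_hull C (mult e l x).
Proof.
move=> l1 [[y l'] [/= Cy l'1] <-].
have ll : disc_valued (fun j => l j * l' j).
  by move=> j; rewrite normrM mulr_ile1.
exists (y, fun j => l j * l' j); first by split.
apply: (coef_inj he) => j; rewrite -[LHS]/(coef e j (mult e (fun j => l j * l' j) y)).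
rewrite (coef_mult he hu y j ll).
rewrite (coef_mult he hu _ j l1).
rewrite (coef_mult he hu _ j l'1).
rewrite mulrA.
reflexivity.
Qed.

Lemma mult1 x : mult e (fun=> 1) x = x.
Proof.
apply: (coef_inj he) => j; rewrite (coef_mult he hu) ?mul1r// => i.
by rewrite normr1.
Qed.

Lemma sub_solid_hull C : C `<=` solid_hull C.
Proof.
move=> x Cx; exists (x, fun=> 1); rewrite ?mult1//; split=> // j.
by rewrite normr1.
Qed.

(** Joint continuity of [(l, x) |-> mult e l x]: the first [N] coordinates are
    compared term by term, and the multipliers act on the tail of [x] with
    norm at most one. *)
Lemma mult_diff_bound l l' x x' N : disc_valued l -> disc_valued l' ->
  `|mult e l' x' - mult e l x| <= `|x' - x| + 2 * `|x - trunc e N x| +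
    \sum_(j < N) `|l' j - l j| * `|coef e j x *: e j|.
Proof.
move=> l1 l'1; pose y := x - trunc e N x.
have -> : mult e l' x' - mult e l x = mult e l' (x' - x) + (mult e l' y - mult e l y)
    + \sum_(j < N) (l' j - l j) *: (coef e j x *: e j).
  have E : \sum_(j < N) (l' j - l j) *: (coef e j x *: e j) =
      mult e l' (trunc e N x) - mult e l (trunc e N x).
    apply: (coef_inj he) => i; rewrite (coefB he) !(coef_mult he hu)// (coef_sum he).
    rewrite -mulrBl (coef_sum he) mulr_sumr; apply: eq_bigr => j _.
    rewrite !(coefZ he) (coef_basis he).
    by case: eqP => [->//|_]; rewrite !mulr0.
  rewrite E /y !(multB he hu)//.
  by rewrite opprB [X in _ = X + _]addrA subrKA addrAC subrKA subrKA.
apply: le_trans (ler_normD _ _) _; apply: lerD.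
  apply: le_trans (ler_normD _ _) _; apply: lerD; first exact: (norm_mult he hu).
  apply: le_trans (ler_normB _ _) _; rewrite mulr_natl mulr2n.
  by apply: lerD; exact: (norm_mult he hu).
apply: le_trans (ler_norm_sum _ _ _) _.
by apply: ler_sum => j _; rewrite normrZ.
Qed.

(** The hull is the continuous image of the product of [C] and a countable
    power of the disc, which is compact by Tychonoff's theorem. *)
Lemma compact_solid_hull C : compact [set z : K^o | `|z| <= 1] -> compact C -> compact (solid_hull C).
Proof.
move=> compact_disc cC.
pose L : set (prod_topology (fun _ : nat => K^o)) := [set l | forall j, `|l j| <= 1].
have cL : compact L by apply: (@tychonoff _ (fun _ : nat => K^o) (fun=> [set z : K^o | `|z| <= 1])).
have cCL : compact (C `*` L) by exact: compact_setX.
suff cont : {within C `*` L, continuous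
    (fun xl : V * prod_topology (fun _ : nat => K^o) => mult e xl.2 xl.1)}.
  exact: continuous_compact cont cCL.
apply/subspace_continuousP => -[x l] [/= Cx Ll].
apply/cvgrPdist_lt => r r0.
have r40 : 0 < r / 4 by rewrite divr_gt0.
have /cvgrPdist_lt/(_ _ r40)[N _ /(_ N (leqnn N)) HN] := trunc_cvg he (x := x).
pose B := 1 + \sum_(j < N) `|coef e j x *: e j|.
have B0 : 0 < B by rewrite ltr_pwDl// sumr_ge0.
have q0 : 0 < r / 4 / B by rewrite divr_gt0.
have Hl : nbhs (x, l) [set xl : V * prod_topology (fun _ : nat => K^o) |
    forall j : 'I_N, `|xl.2 (j : nat) - l (j : nat)| < r / 4 / B].
  apply: (@filter_forall _ 'I_N (fun j => [set xl : V * prod_topology (fun _ : nat => K^o) |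
    `|xl.2 (j : nat) - l (j : nat)| < r / 4 / B]) (nbhs (x, l))) => j.
  have cj : continuous (fun l' : prod_topology (fun _ : nat => K^o) => l' (j : nat)).
    exact: (@proj_continuous _ (fun _ : nat => K^o)).
  have H : (fun q : V * prod_topology (fun _ : nat => K^o) => q.2 (j : nat)) @ (x, l)
      --> l j.
    have S : (fun q : V * prod_topology (fun _ : nat => K^o) => q.2) @ (x, l) --> l.
      exact: cvg_snd.
    exact: (cvg_comp _ _ S (cj l)).
  by have /cvgrPdist_lt/(_ _ q0) := H; apply: filterS => xl'; rewrite distrC.
near=> xl'; have [/= Cx' Ll'] : (C `*` L) xl'.
  by near: xl'; exact: withinT.
rewrite distrC; apply: le_lt_trans (mult_diff_bound x xl'.1 N Ll Ll') _.
have h1 : `|xl'.1 - x| < r / 4.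
  rewrite distrC; near: xl'; apply: cvg_within.
  have H : (fun q : V * prod_topology (fun _ : nat => K^o) => q.1) @ (x, l) --> x.
    exact: cvg_fst.
  by have /cvgrPdist_lt/(_ _ r40) := H.
have h2 (j : 'I_N) : `|xl'.2 j - l j| < r / 4 / B.
  by move: j; near: xl'; exact: cvg_within.
apply: (@lt_le_trans _ _ (r / 4 + 2 * (r / 4) + r / 4)); last first.
  by rewrite mulr_natl mulr2n -!mulrDr; apply: le_of_eq; field.
apply: ltr_leD; first by apply: ltr_leD => //; rewrite ler_pM2l// ltW.
apply: (@le_trans _ _ (\sum_(j < N) (r / 4 / B) * `|coef e j x *: e j|)).
  by apply: ler_sum => j _; rewrite ler_wpM2r// ltW.
rewrite -mulr_sumr -mulrA -[leRHS]mulr1 ler_pM2l// ler_pdivrMl// mulr1.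
by rewrite /B lerDr.
Unshelve. all: by end_near. Qed.

End SolidHull.

(** * Projections of polynomials along the square order *)

Section MultiIndices.
Implicit Types al be : multiindex.

Lemma big_finsupp (T : Type) (idx : T) (op : Monoid.com_law idx) al (F : nat -> T) J :
  (forall j, al j <> 0%N -> (j < J)%N) -> (forall j, al j = 0%N -> F j = idx) ->
  \big[op/idx]_(j <- finsupp al) F j = \big[op/idx]_(j < J) F j.
Proof.
move=> alJ F0; rewrite -(big_mkord xpredT F).
rewrite [RHS](bigID (mem (finsupp al)))/= [X in op _ X]big1 ?Monoid.mulm1; last first.
  by move=> j; rewrite memNfinsupp => /eqP /F0.
rewrite -[RHS]big_filter; apply: perm_big; apply: uniq_perm.
- exact: fset_uniq.
- by rewrite filter_uniq// iota_uniq.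
move=> j; rewrite mem_filter mem_index_iota/=; case: finsuppP => //= jal.
  by rewrite alJ// => /eqP; apply/negP; rewrite -mem_finsupp.
Qed.

Lemma mlen_gt al j : al j <> 0%N -> (j < mlen al)%N.
Proof.
move=> /eqP; rewrite -mem_finsupp => jal; rewrite /mlen.
exact: (@leq_bigmax_seq _ _ xpredT (fun j => j.+1)).
Qed.

Lemma mlen_top al l : mlen al = l.+1 -> al l <> 0%N.
Proof.
move=> E; apply/eqP; rewrite -mem_finsupp.
suff H (s : seq nat) : (\max_(j <- s) j.+1)%N = l.+1 -> l \in s by exact: H E.
elim: s => [|i s ih]; first by rewrite big_nil.
rewrite big_cons in_cons {1}/maxn; case: ifP => _; first by move/ih ->; rewrite orbT.
by case=> ->; rewrite eqxx.
Qed.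

Lemma mlen_eq0 al j : (mlen al <= j)%N -> al j = 0%N.
Proof. by move=> h; apply/eqP/negPn/negP => /eqP/mlen_gt; rewrite ltnNge h. Qed.

Lemma mdegE al J : (mlen al <= J)%N -> mdeg al = (\sum_(j < J) al j)%N.
Proof.
by move=> aJ; apply: big_finsupp => // j /mlen_gt jm; exact: leq_trans jm aJ.
Qed.

(** A strict inequality of lengths is itself a comparison at the last
    differing coordinate, which is then the last coordinate of [be]. *)
Lemma square_lt_top al be j : al j <> be j ->
  (forall i, (j < i)%N -> al i = be i) -> square_lt al be <-> (al j < be j)%N.
Proof.
move=> abj top; split.
  case=> [lt|[_ [i [abi topi lt]]]].
    have [l bE] : exists l, mlen be = l.+1 by exists (mlen be).-1; rewrite prednK//; lia.
    have bl := mlen_top bE; have al0 : al l = 0%N by apply: mlen_eq0; lia.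
    have jl : j = l.
      apply/eqP; rewrite eqn_leq; apply/andP; split.
        rewrite leqNgt; apply/negP => lj; apply: abj.
        by rewrite !mlen_eq0//; lia.
      by rewrite leqNgt; apply/negP => /top; rewrite al0 => /esym.
    by rewrite jl al0; lia.
  have ij : i = j.
    apply/eqP; rewrite eqn_leq topi// andbT leqNgt; apply/negP => /top.
    exact: abi.
  by rewrite -ij.
move=> lt; have [ltm|gtm|eqm] := ltngtP (mlen al) (mlen be); first by left.
  have [l aE] : exists l, mlen al = l.+1 by exists (mlen al).-1; rewrite prednK//; lia.
  have al0 := mlen_top aE.
  have jb : (j < mlen be)%N by apply: mlen_gt; lia.
  have := top l; rewrite (@mlen_eq0 be l); last by lia.
  by move=> /(_ ltac:(lia)).
right; split=> //; exists j; split=> // i abi.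
by rewrite leqNgt; apply/negP => /top.
Qed.

(** Comparison of the first [J] coordinates starting from the last one.
    Peeling off the last coordinate is what makes the norm of the
    corresponding projection computable by induction. *)
Fixpoint colex_le (be al : multiindex) J : bool :=
  if J is J'.+1 then (al J' < be J')%N || ((al J' == be J') && colex_le be al J')
  else true.

Lemma colex_le_refl al J : colex_le al al J.
Proof. by elim: J => //= J ->; rewrite eqxx orbT. Qed.

Lemma colex_le_top be al j J : (j < J)%N -> al j <> be j ->
  (forall i, (j < i)%N -> al i = be i) -> colex_le be al J = (al j < be j)%N.
Proof.
move=> + abj top; elim: J => // J ih; rewrite ltnS leq_eqVlt /= => /predU1P[<-|jJ].
  by move/eqP/negbTE : abj => ->; rewrite orbF.
by rewrite (top J jJ) ltnn eqxx ih.
Qed.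

Lemma colex_leP be al J : (mlen al <= J)%N -> (mlen be <= J)%N ->
  colex_le be al J <-> al = be \/ square_lt al be.
Proof.
move=> aJ bJ; have [->|/eqP ab] := eqVneq al be.
  by split=> [_|_]; [left|exact: colex_le_refl].
have : exists j, (j < J)%N && (al j != be j).
  apply: contrapT => nH; apply: ab; apply/fsfunP => j.
  apply/eqP/negPn/negP => abj; apply: nH; exists j; rewrite abj andbT.
  rewrite ltnNge; apply/negP => Jj; move: abj.
  by rewrite !mlen_eq0 ?(leq_trans _ Jj)// eqxx.
move=> exj; have bd i : (i < J)%N && (al i != be i) -> (i <= J)%N by case/andP => /ltnW.
have [j /andP[jJ /eqP abj] top] := ex_maxnP exj bd.
have {}top i : (j < i)%N -> al i = be i.
  move=> ji; apply/eqP/negPn/negP => abi.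
  have iJ : (i < J)%N.
    rewrite ltnNge; apply/negP => Ji; move: abi.
    by rewrite !mlen_eq0 ?(leq_trans _ Ji)// eqxx.
  by have := top i; rewrite iJ abi leqNgt ji => /(_ isT).
rewrite (colex_le_top jJ abj top) (square_lt_top abj top).
by split=> [|[]//]; right.
Qed.

End MultiIndices.

Section Projections.
Local Open Scope classical_set_scope.
Local Open Scope ring_scope.
Context {K : numFieldType} {V : normedModType K} (e : nat -> V).
Hypothesis he : schauder_basis e.
Hypothesis hu : one_unconditional e.
Context (zeta : nat -> nat -> K).
Hypothesis norm_zeta : forall N k, `|zeta N k| = 1.
Hypothesis zeta_mean : forall N a b, (a < 2 ^ N)%N -> (b < 2 ^ N)%N ->
  (2 ^+ N)^-1 * \sum_(k < 2 ^ N) (zeta N k ^+ a / zeta N k ^+ b) = (a == b)%:R.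
Context (A : nat -> multiindex).
Implicit Types (a : nat -> K) (x : V) (S : set V) (G : pred nat).

Definition msum a r x : K := \sum_(k < r) a k * monomial e (A k) x.

Definition restr G a : nat -> K := fun k => if G k then a k else 0.

Definition solid S := forall l x, disc_valued l -> S x -> S (mult e l x).

(** The projection of polynomials onto the monomials with index in [G] has
    norm at most [c] for the supremum over [S]. *)
Definition projects S r G (c : K) := forall a B,
  (forall x, S x -> `|msum a r x| <= B) ->
  forall x, S x -> `|msum (restr G a) r x| <= c * B.

Lemma monomial_mult l al x : disc_valued l ->
  monomial e al (mult e l x) = (\prod_(j <- finsupp al) l j ^+ al j) * monomial e al x.
Proof.
move=> l1; rewrite /monomial -big_split; apply: eq_bigr => j _ /=.
by rewrite (coef_mult he hu)// exprMn.
Qed.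

Lemma eq_projects S r G G' c : (forall k, (k < r)%N -> G k = G' k) ->
  projects S r G c -> projects S r G' c.
Proof.
move=> GG' H a B aB x Sx; have := H a B aB x Sx; congr (`|_| <= _).
by apply: eq_bigr => k _; rewrite /restr GG'.
Qed.

(** The terms on which [lam z] acts by [z ^ c] are extracted by averaging over
    the roots of unity [z]. The set [S] is stable under the rotations, so the
    average does not exceed the supremum. *)
Lemma projects_rotation S r (w : nat -> nat) (c : nat) (lam : K -> nat -> K) :
  solid S -> (forall z, `|z| = 1 -> disc_valued (lam z)) ->
  (forall z k, `|z| = 1 -> \prod_(j <- finsupp (A k)) lam z j ^+ A k j = z ^+ w k) ->
  projects S r (fun k => w k == c) 1.
Proof.
move=> sS lam1 lamE a B aB x Sx.
have [N [cN wN]] : exists N, (c < 2 ^ N)%N /\ forall k, (k < r)%N -> (w k < 2 ^ N)%N.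
  exists (c + \sum_(k < r) w k)%N; split=> [|k kr].
    by apply: leq_trans (ltn_expl _ (isT : 1 < 2)%N) _; rewrite leq_exp2l// leq_addr.
  apply: leq_trans (ltn_expl _ (isT : 1 < 2)%N) _; rewrite leq_exp2l//.
  by rewrite (bigD1 (Ordinal kr))//= addnCA leq_addr.
have P0 : 0 < 2 ^+ N :> K by rewrite exprn_gt0.
have -> : msum (restr (fun k => w k == c) a) r x =
    (2 ^+ N)^-1 * \sum_(t < 2 ^ N) msum a r (mult e (lam (zeta N t)) x) / zeta N t ^+ c.
  rewrite /msum; under [in RHS]eq_bigr do rewrite mulr_suml.
  rewrite exchange_big mulr_sumr; apply: eq_bigr => k _.
  transitivity (a k * monomial e (A k) x * (w k == c)%:R).
    by rewrite /restr; case: eqP => _; rewrite ?mulr1// mul0r mulr0.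
  rewrite -(zeta_mean (wN k (ltn_ord k)) cN) mulrCA; congr (_ * _).
  rewrite mulr_sumr; apply: eq_bigr => t _.
  by rewrite monomial_mult ?lamE//; [ring|exact: lam1].
rewrite normrM gtr0_norm ?invr_gt0// mul1r ler_pdivrMl//.
apply: le_trans (ler_norm_sum _ _ _) _.
apply: (@le_trans _ _ (\sum_(t < 2 ^ N) B)).
  apply: ler_sum => t _; rewrite normrM normfV normrX norm_zeta expr1n invr1 mulr1.
  by apply: aB; apply: sS => //; exact: lam1.
by rewrite sumr_const card_ord -[leLHS]mulr_natl natrX.
Qed.

Lemma projects_coord S r j c : solid S -> projects S r (fun k => A k j == c) 1.
Proof.
move=> sS; apply: (@projects_rotation _ _ _ _ (fun z i => if i == j then z else 1)) => //.
  by move=> z z1 i; case: eqP; rewrite ?z1 ?normr1.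
move=> z k _.
pose J := maxn (mlen (A k)) j.+1.
rewrite (@big_finsupp _ _ _ _ (fun i => (if i == j then z else 1) ^+ A k i) J); first last.
- by move=> i ->; rewrite expr0.
- by move=> i /mlen_gt; rewrite leq_max => ->.
have jJ : (j < J)%N by rewrite leq_max leqnn orbT.
rewrite (bigD1 (Ordinal jJ))//= eqxx big1 ?mulr1// => i.
by rewrite -val_eqE /= => /negbTE ->; rewrite expr1n.
Qed.

Lemma projects_mdeg S r n : solid S -> projects S r (fun k => mdeg (A k) == n) 1.
Proof.
move=> sS; apply: (@projects_rotation _ _ _ _ (fun z _ => z)) => //.
  by move=> z z1 i; rewrite z1.
by move=> z k _; rewrite /mdeg expr_sum.
Qed.

Lemma projects_and S r G G' c c' : projects S r G c -> projects S r G' c' ->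
  projects S r (fun k => G k && G' k) (c' * c).
Proof.
move=> H H' a B aB x Sx; rewrite -mulrA.
have := H' _ _ (H a B aB) x Sx; congr (`|_| <= _).
by apply: eq_bigr => k _; rewrite /restr; case: (G k); case: (G' k).
Qed.

Lemma projects_or S r G G' c c' : (forall k, G k -> G' k -> False) ->
  projects S r G c -> projects S r G' c' ->
  projects S r (fun k => G k || G' k) (c + c').
Proof.
move=> dis H H' a B aB x Sx.
have -> : msum (restr (fun k => G k || G' k) a) r x =
    msum (restr G a) r x + msum (restr G' a) r x.
  rewrite /msum -big_split; apply: eq_bigr => k _; rewrite /restr /= -mulrDl.
  have := dis k; case: (G k); case: (G' k) => /= H0; rewrite ?addr0 ?add0r//.
  by have := H0 isT isT.
apply: le_trans (ler_normD _ _) _; rewrite mulrDl.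
by apply: lerD; [exact: H|exact: H'].
Qed.

Lemma projects_coord_lt S r j n : solid S -> projects S r (fun k => A k j < n)%N n%:R.
Proof.
move=> sS; elim: n => [|n ih].
  move=> a B _ x _; rewrite mul0r /msum big1 ?normr0// => k _.
  by rewrite /restr ltn0 mul0r.
rewrite -natr1; apply: eq_projects (projects_or _ ih (@projects_coord S r j n sS)).
  by move=> k _; rewrite ltnS [RHS]leq_eqVlt orbC.
by move=> k /= + /eqP E; rewrite E ltnn.
Qed.

(** Being smaller at the last coordinate means taking one of [be J] values
    there, and each value costs one projection of norm one; being equal there
    costs one more such projection, after which the remaining coordinates are
    compared. *)
Lemma projects_colex S r be J : solid S ->
  projects S r (fun k => colex_le be (A k) J) (1 + \sum_(j < J) be j)%N%:R.
Proof.
move=> sS; elim: J => [|J ih] /=.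
  rewrite big_ord0 addn0 => a B aB x Sx; rewrite mul1r; exact: aB.
have -> : (1 + \sum_(j < J.+1) be j)%N%:R =
    (be J)%:R + (1 + \sum_(j < J) be j)%N%:R * 1 :> K.
  by rewrite big_ord_recr /= mulr1 -natrD; congr _%:R; lia.
apply: projects_or; last 2 first.
- exact: projects_coord_lt.
- by apply: projects_and ih; exact: projects_coord.
by move=> k /= lt /andP[/eqP E _]; rewrite E ltnn in lt.
Qed.

Lemma monomialZ c al x : monomial e al (c *: x) = c ^+ mdeg al * monomial e al x.
Proof.
rewrite /monomial /mdeg expr_sum -big_split; apply: eq_bigr => j _ /=.
by rewrite (coefZ he) exprMn.
Qed.

(** The norms [n + 1] of the projections in degree [n], weighted by the
    scaling factors [2 ^- n] of that degree. *)
Lemma sum_dyadic D : \sum_(n < D) (n.+1%:R / 2 ^+ n) <= 4 :> K.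
Proof.
suff -> : \sum_(n < D) (n.+1%:R / 2 ^+ n) = 4 - D.+2%:R * 2 / 2 ^+ D :> K.
  by rewrite gerBl// divr_ge0// mulr_ge0.
elim: D => [|D ih]; first by rewrite big_ord0; field.
rewrite big_ord_recr ih /= exprS.
have P0 : 2 ^+ D != 0 :> K by rewrite expf_neq0// pnatr_eq0.
have -> : D.+3%:R = D%:R + 3 :> K by rewrite -addn3 natrD.
have -> : D.+2%:R = D%:R + 2 :> K by rewrite -addn2 natrD.
have -> : D.+1%:R = D%:R + 1 :> K by rewrite -addn1 natrD.
by field.
Qed.

Hypothesis A_compatible : compatible A.

(** Within a given degree, the monomials that occur in the [q]-th partial sum
    are those up to the last of them, [be], in the square order. *)
Lemma initial_segment n q : (exists2 k, (k < q)%N & mdeg (A k) = n) ->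
  exists2 be, mdeg be = n & forall k J, mdeg (A k) = n ->
    (mlen (A k) <= J)%N -> (mlen be <= J)%N -> (k < q)%N = colex_le be (A k) J.
Proof.
move=> [k1 k1q dk1].
have exk : exists k, (k < q)%N && (mdeg (A k) == n) by exists k1; rewrite k1q dk1 eqxx.
have bd k : (k < q)%N && (mdeg (A k) == n) -> (k <= q)%N by case/andP => /ltnW.
have [k0 /andP[k0q /eqP dk0] top] := ex_maxnP exk bd.
exists (A k0) => // k J dk kJ k0J.
have [_ cA] := A_compatible.
apply/idP/idP => [kq|/(colex_leP kJ k0J)[E|]].
- apply/(colex_leP kJ k0J).
  have : (k <= k0)%N by apply: top; rewrite kq dk eqxx.
  rewrite leq_eqVlt => /predU1P[->|kk0]; first by left.
  by right; apply/cA; rewrite ?dk ?dk0.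
- by rewrite (bij_inj A_compatible.1 E).
move=> sq; have kk0 : (k < k0)%N by apply/cA; rewrite ?dk ?dk0.
exact: ltn_trans kk0 k0q.
Qed.

(** In degree [n], the partial sum is the projection onto an initial segment
    of the square order, of norm at most [n + 1] by [projects_colex]; the
    homogeneous part itself is bounded by [B / 2 ^ n] on [S] because [B]
    bounds the polynomial on the double of [S]. *)
Lemma msum_bound S a q r B : solid S -> (q <= r)%N ->
  (forall x, S x -> `|msum a r (2 *: x)| <= B) ->
  forall x, S x -> `|msum a q x| <= 4 * B.
Proof.
move=> sS qr aB x Sx.
have B0 : 0 <= B by exact: le_trans (aB x Sx).
(* the homogeneous parts are first bounded on the double of [S] *)
pose S2 : set V := [set 2 *: y | y in S].
have sS2 : solid S2.
  move=> l _ l1 [y Sy <-]; exists (mult e l y); first exact: sS.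
  apply: (coef_inj he) => j.
  by rewrite (coefZ he) !(coef_mult he hu)// (coefZ he) mulrCA.
have aB2 y : S2 y -> `|msum a r y| <= B by case=> z /aB ? <-.
pose an n := restr (fun k => mdeg (A k) == n) a.
have anB n y : S y -> `|msum (an n) r y| <= B / 2 ^+ n.
  move=> Sy; have P0 : 0 < 2 ^+ n :> K by rewrite exprn_gt0.
  have := @projects_mdeg S2 r n sS2 a B aB2 (2 *: y) (imageP _ Sy).
  have -> : msum (an n) r (2 *: y) = 2 ^+ n * msum (an n) r y.
    rewrite /msum mulr_sumr; apply: eq_bigr => k _; rewrite /an /restr.
    by case: eqP => [dk|_]; rewrite ?mul0r ?mulr0// monomialZ dk mulrCA.
  by rewrite normrM gtr0_norm// mul1r ler_pdivlMr// mulrC.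
pose J := (\sum_(k < r) mlen (A k))%N.
have lenJ k : (k < r)%N -> (mlen (A k) <= J)%N.
  by move=> kr; rewrite /J (bigD1 (Ordinal kr))//= leq_addr.
have piece n : `|msum (restr (fun k => k < q)%N (an n)) r x| <= n.+1%:R / 2 ^+ n * B.
  have [ex|nex] := pselect (exists2 k, (k < q)%N & mdeg (A k) = n); last first.
    rewrite /msum big1 ?normr0 ?mulr_ge0// => k _.
    rewrite /restr /an /restr; case: ltnP => kq; last by rewrite mul0r.
    case: eqP => [dk|_]; last by rewrite mul0r.
    by case: nex; exists k.
  have [be dbe beP] := initial_segment ex.
  pose J' := maxn J (mlen be).
  have := @projects_colex S r be J' sS (an n) _ (anB n) x Sx.
  rewrite -(mdegE (leq_maxr _ _)) dbe add1n mulrA mulrAC.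
  congr (`|_| <= _); apply: eq_bigr => k _; rewrite /restr /an /restr.
  case: eqP => [dk|_]; last by rewrite !if_same.
  by rewrite (beP k J') ?leq_maxr// leq_max lenJ.
pose D := (\sum_(k < r) mdeg (A k)).+1.
have -> : msum a q x = \sum_(n < D) msum (restr (fun k => k < q)%N (an n)) r x.
  rewrite /msum exchange_big /=.
  rewrite (big_ord_widen _ (fun k => a k * monomial e (A k) x) qr) big_mkcond.
  apply: eq_bigr => k _; rewrite /restr /an /restr -mulr_suml.
  case: ltnP => kq; last by rewrite big1 ?mul0r.
  have kD : (mdeg (A k) < D)%N by rewrite ltnS (bigD1 k)//= leq_addr.
  rewrite (bigD1 (Ordinal kD))//= eqxx big1 ?addr0// => n.
  by rewrite -val_eqE /= eq_sym => /negbTE ->.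
apply: le_trans (ler_norm_sum _ _ _) _.
apply: le_trans (ler_sum _ (fun (n : 'I_D) _ => piece n)) _.
by rewrite -mulr_suml ler_wpM2r// sum_dyadic.
Qed.

End Projections.

(** * Density of polynomials *)

Section GeometricSum.
Local Open Scope ring_scope.
Context {K : numFieldType}.
Implicit Types u v : K.

Lemma norm_geom M u : `|u| <= 2^-1 -> `|geom M u| <= 4.
Proof.
move=> u2; apply: le_trans (ler_norm_sum _ _ _) _.
apply: le_trans _ (@sum_dyadic K M); apply: ler_sum => k _.
rewrite normrX; apply: (@le_trans _ _ (2^-1 ^+ k)); first by rewrite lerXn2r ?nnegrE.
by rewrite exprVn ler_peMl ?invr_ge0 ?exprn_ge0// ler1n.
Qed.

Lemma geom_lip M u v : `|u| <= 2^-1 -> `|v| <= 2^-1 ->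
  `|geom M u - geom M v| <= 4 * `|u - v|.
Proof.
move=> u2 v2.
have pow k : `|u ^+ k.+1 - v ^+ k.+1| <= k.+1%:R / 2 ^+ k * `|u - v|.
  elim: k => [|k ih]; first by rewrite !expr1 divr1 mul1r.
  have -> : u ^+ k.+2 - v ^+ k.+2 = u * (u ^+ k.+1 - v ^+ k.+1) + (u - v) * v ^+ k.+1.
    by rewrite !(exprS _ k.+1); ring.
  apply: le_trans (ler_normD _ _) _; rewrite !normrM.
  apply: (@le_trans _ _ (2^-1 * (k.+1%:R / 2 ^+ k * `|u - v|) + `|u - v| * (2^-1) ^+ k.+1)).
    apply: lerD; first by apply: ler_pM.
    by rewrite ler_wpM2l// normrX lerXn2r ?nnegrE.
  apply: le_of_eq; rewrite -[k.+2%:R]natr1 exprVn exprS; field.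
  by rewrite expf_neq0// pnatr_eq0.
rewrite /geom -sumrB; case: M => [|M]; first by rewrite big_ord0 normr0 mulr_ge0.
rewrite big_ord_recl !expr0 subrr add0r; apply: le_trans (ler_norm_sum _ _ _) _.
apply: le_trans (ler_sum _ (fun (k : 'I_M) _ => pow k)) _.
by rewrite -mulr_suml ler_wpM2r// sum_dyadic.
Qed.

End GeometricSum.

Section Density.
Local Open Scope classical_set_scope.
Local Open Scope ring_scope.
Context {K : numFieldType} {V : normedModType K} (e : nat -> V).
Hypothesis he : schauder_basis e.
Hypothesis hu : one_unconditional e.

Definition entire (h : K -> K) := forall u0, exists A, forall r : K, 0 < r ->
  exists2 d, 0 < d & forall u, `|u - u0| < d ->
    `|h u - h u0 - A * (u - u0)| <= r * `|u - u0|.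

Context (zeta : nat -> nat -> K).
Hypothesis norm_zeta : forall N k, `|zeta N k| = 1.

Hypothesis interpolant_cvg : forall rho h z r, entire h -> 0 < rho ->
  `|z| <= rho / 2 -> 0 < r ->
  exists N0, forall N, (N0 <= N)%N -> `|interpolant zeta N rho h z - h z| < r.
Hypothesis compact_unit_disc : compact [set z : K^o | `|z| <= 1].
Hypothesis bounded_on_compact : forall (T : topologicalType) (g : T -> K^o) (C : set T),
  continuous g -> compact C -> exists2 B : K, 0 < B & forall x, C x -> `|g x| <= B.

Implicit Types (f g : V -> K^o) (x : V) (C : set V).

Definition frechet_entire f := forall x, differentiable f x.

Definition replace_coord j x (w : K) : V := x - coef e j x *: e j + w *: e j.

Lemma replace_coord_id j x : replace_coord j x (coef e j x) = x.
Proof. by rewrite /replace_coord subrK. Qed.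

Lemma coef_continuous j : continuous (coef e j : V -> K^o).
Proof. exact: he.2. Qed.

Lemma replace_coord_continuous (T : topologicalType) j (p : T -> V) (w : T -> K^o) t :
  {for t, continuous p} -> {for t, continuous w} ->
  {for t, continuous (fun s => replace_coord j (p s) (w s))}.
Proof.
move=> cp cw; apply: cvgD; last first.
  exact: cvgZr_tmp.
apply: cvgB => //; apply: cvgZr_tmp.
exact: (continuous_comp cp (@coef_continuous j _)).
Qed.

Lemma entire_slice f j x : frechet_entire f -> entire (fun w => f (replace_coord j x w)).
Proof.
move=> df w0; set p := replace_coord j x w0.
have /diff_locally/eqaddoP H := df p.
exists ('d f p (e j)) => r r0.
have n0 : 0 < `|e j| + 1 by rewrite ltr_wpDl.
have r'0 : 0 < r / (`|e j| + 1) by rewrite divr_gt0.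
have /nbhs_ballP[d /= d0 Hd] := H _ r'0.
exists (d / (`|e j| + 1)); first by rewrite divr_gt0.
move=> w; rewrite ltr_pdivlMr// => wd.
have small : `|(w - w0) *: e j| <= `|w - w0| * (`|e j| + 1).
  by rewrite normrZ ler_wpM2l// lerDl.
have /= := Hd ((w - w0) *: e j); rewrite -ball_normE /= sub0r normrN.
move=> /(_ (le_lt_trans small wd)).
rewrite -[(_ - _) _]/(f ((w - w0) *: e j + p) - (f p + 'd f p ((w - w0) *: e j))).
have -> : (w - w0) *: e j + p = replace_coord j x w.
  by rewrite /p /replace_coord addrCA -scalerDl subrK.
rewrite linearZ /= opprD addrA -[_ *: 'd f p _]/((w - w0) * 'd f p (e j)).
rewrite [(w - w0) * _]mulrC => /le_trans; apply.
by rewrite mulrAC ler_pdivrMr// -mulrA ler_pM2l.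
Qed.

Section OneVariable.
Context (j : nat) (rho : K).
Hypothesis rho0 : 0 < rho.

Definition interpolate N f x : K :=
  interpolant zeta N rho (fun w => f (replace_coord j x w)) (coef e j x).

Let norm_node N t : `|rho * zeta N t| = rho.
Proof. by rewrite normrM norm_zeta mulr1 gtr0_norm. Qed.

Let half_node N t z : `|z| <= rho / 2 -> `|z / (rho * zeta N t)| <= 2^-1.
Proof.
by move=> z2; rewrite normrM normfV norm_node ler_pdivrMr// mulrC.
Qed.

(** Compactness of the disc makes the slices of [f] through nearby points
    uniformly close. *)
Lemma near_slices f x0 (r : K) : continuous f -> 0 < r ->
  \forall x \near x0, forall z, `|z| = rho -> `|f (replace_coord j x0 z) - f (replace_coord j x z)| < r.
Proof.
move=> cf r0; have r20 : 0 < r / 2 by rewrite divr_gt0.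
pose F (x : V) (u : K^o) := f (replace_coord j x (rho * u)).
have cF xu : {for xu, continuous (fun xu : V * K^o => F xu.1 xu.2)}.
  apply: (continuous_comp _ (cf _)); apply: replace_coord_continuous; first exact: cvg_fst.
  by apply: cvgMr; exact: cvg_snd.
have /compact_near_coveringP/(_ V (nbhs x0) (fun x u => `|F x0 u - F x u| < r) _) H :=
  compact_unit_disc.
have {}H : \forall x \near x0, [set z : K^o | `|z| <= 1] `<=` (fun u => `|F x0 u - F x u| < r).
  apply: H => u0 u01.
  have c0 : \forall u \near u0, `|F x0 u0 - F x0 u| < r / 2.
    have cu : {for u0, continuous (fun u : K^o => F x0 u)}.
      apply: (continuous_comp _ (cf _)).
      apply: (@replace_coord_continuous _ j (fun=> x0) (fun u : K^o => rho * u)).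
        exact: (@cst_continuous K^o V x0).
      exact: mulrl_continuous.
    by have /cvgrPdist_lt/(_ _ r20) := cu.
  have /cvgrPdist_lt/(_ _ r20) c1 := cF (x0, u0).
  have c1' : \forall u \near u0 & x \near x0, `|F x0 u0 - F x u| < r / 2.
    by case: c1 => -[P Q] /= [Px Qu] PQ; exists (Q, P) => // -[u x] [/= ? ?]; exact: (PQ (x, u)).
  have c0' : \forall u \near u0 & x \near x0, `|F x0 u0 - F x0 u| < r / 2.
    exists ([set u | `|F x0 u0 - F x0 u| < r / 2], setT); first by split=> //; exact: filterT.
    by move=> -[u x] [].
  apply: filterS2 c0' c1' => -[u x] /= h0 h1.
  apply: le_lt_trans (ler_distD (F x0 u0) _ _) _.
  by rewrite (splitr r); apply: ltrD => //; rewrite distrC.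
apply: filterS H => x Hx z zr.
have -> : z = rho * (z / rho) by rewrite mulrC divfK// gt_eqF.
apply: (Hx (z / rho)) => /=.
by rewrite normrM normfV zr gtr0_norm// divff// gt_eqF.
Qed.

(** The interpolation polynomials are equicontinuous in the function and in
    the point, uniformly in [N]: on the disc of half the radius, the geometric
    sums are bounded and Lipschitz independently of their length. *)
Lemma interpolant_lip N (g g' : K -> K) z z' M d :
  `|z| <= rho / 2 -> `|z'| <= rho / 2 -> 0 <= M ->
  (forall w, `|w| = rho -> `|g w| <= M) ->
  (forall w, `|w| = rho -> `|g w - g' w| <= d) ->
  `|interpolant zeta N rho g z - interpolant zeta N rho g' z'| <= 4 * d + M * (4 * (`|z - z'| / rho)).
Proof.
move=> z2 z'2 M0 gM gg'.
have P0 : 0 < 2 ^+ N :> K by rewrite exprn_gt0.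
rewrite /interpolant -mulrBr normrM gtr0_norm ?invr_gt0// ler_pdivrMl// -sumrB.
apply: le_trans (ler_norm_sum _ _ _) _.
apply: (@le_trans _ _ (\sum_(t < 2 ^ N) (4 * d + M * (4 * (`|z - z'| / rho))))); last first.
  by rewrite sumr_const card_ord -[leLHS]mulr_natl natrX.
apply: ler_sum => t _; set w := rho * zeta N t.
have -> : g w * geom (2 ^ N) (z / w) - g' w * geom (2 ^ N) (z' / w) =
    (g w - g' w) * geom (2 ^ N) (z' / w) +
    g w * (geom (2 ^ N) (z / w) - geom (2 ^ N) (z' / w)) by ring.
apply: le_trans (ler_normD _ _) _; rewrite !normrM; apply: lerD.
  rewrite mulrC; apply: ler_pM => //; last exact: gg' (norm_node _ _).
  by apply: norm_geom; exact: half_node.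
apply: ler_pM => //; first exact: gM (norm_node _ _).
apply: le_trans (geom_lip _ (half_node _ _ z2) (half_node _ _ z'2)) _.
by rewrite -mulrBl normrM normfV norm_node.
Qed.

(** Pointwise convergence, by [interpolant_cvg] for the slice through each
    point, becomes uniform on compact sets by the equicontinuity of
    [interpolant_lip]. *)
Lemma interpolate_uniform f C (r : K) : frechet_entire f -> compact C ->
  (forall x, C x -> `|coef e j x| <= rho / 2) -> 0 < r ->
  exists N, forall x, C x -> `|f x - interpolate N f x| < r.
Proof.
move=> df cC C2 r0.
have cf : continuous f by move=> x; exact: differentiable_continuous.
suff H : \forall N \near \oo, C `<=` (fun x => `|f x - interpolate N f x| < r).
  by case: H => N _ /(_ N (leqnn N)) HN; exists N.
have /compact_near_coveringP/near_covering_withinP := cC.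
apply => x0 Cx0.
have r4 : 0 < r / 4 by rewrite divr_gt0.
have cslice u : {for u, continuous (fun u : K^o => f (replace_coord j x0 (rho * u)))}.
  apply: (continuous_comp _ (cf _)).
  apply: (@replace_coord_continuous _ j (fun=> x0) (fun u : K^o => rho * u)).
    exact: (@cst_continuous K^o V x0).
  exact: mulrl_continuous.
have [M M0 HM] := bounded_on_compact cslice compact_unit_disc.
have gM w : `|w| = rho -> `|f (replace_coord j x0 w)| <= M.
  move=> wr; have -> : w = rho * (w / rho) by rewrite mulrC divfK// gt_eqF.
  by apply: HM => /=; rewrite normrM normfV wr gtr0_norm// divff// gt_eqF.
have r32 : 0 < r / 32 by rewrite divr_gt0.
have s0 : 0 < r / 32 * rho / M by rewrite !(divr_gt0, mulr_gt0).
have [N0 HN0] := interpolant_cvg (entire_slice j x0 df) rho0 (C2 _ Cx0) r4.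
have n1 : \forall x \near x0, `|f x0 - f x| < r / 4.
  by have /cvgrPdist_lt/(_ _ r4) := cf x0.
have n2 : \forall x \near x0, `|coef e j x0 - coef e j x| < r / 32 * rho / M.
  by have /cvgrPdist_lt/(_ _ s0) := @coef_continuous j x0.
have n3 := near_slices x0 cf r32.
have n4 : \forall x \near x0, [/\ `|f x0 - f x| < r / 4,
   `|coef e j x0 - coef e j x| < r / 32 * rho / M &
   forall z, `|z| = rho -> `|f (replace_coord j x0 z) - f (replace_coord j x z)| < r / 32].
  by apply: filterS3 n1 n2 n3.
have n5 : \forall N \near \oo, (N0 <= N)%N by exact: nbhs_infty_ge.
exists ([set x | [/\ `|f x0 - f x| < r / 4,
   `|coef e j x0 - coef e j x| < r / 32 * rho / M &
   forall z, `|z| = rho -> `|f (replace_coord j x0 z) - f (replace_coord j x z)| < r / 32]],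
   [set N | (N0 <= N)%N]) => //.
move=> -[x N] [/= [h1 h2 h3] NN] Cx.
have h4 : `|interpolate N f x0 - interpolate N f x| <=
    4 * (r / 32) + M * (4 * (`|coef e j x0 - coef e j x| / rho)).
  apply: interpolant_lip; rewrite ?C2// ?ltW// => w wr; apply/ltW; exact: h3.
have h5 : M * (4 * (`|coef e j x0 - coef e j x| / rho)) <= 4 * (r / 32).
  rewrite mulrCA ler_pM2l// mulrA ler_pdivrMr// -ler_pdivlMl// mulrC.
  exact: ltW.
have h6 := HN0 N NN; rewrite /= replace_coord_id in h6.
apply: le_lt_trans (ler_distD (f x0) _ _) _.
apply: le_lt_trans (lerD (lexx _) (ler_distD (interpolate N f x0) _ _)) _.
have -> : r = r / 4 + (r / 4 + (4 * (r / 32) + 4 * (r / 32) + r / 4)) by field.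
apply: ltrD; first by rewrite distrC.
apply: ltrD; first by rewrite distrC.
by apply: le_lt_trans h4 _; apply: ltr_pwDr => //; apply: lerD.
Qed.

End OneVariable.

Context (A : nat -> multiindex).
Hypothesis A_surj : forall al, exists k, A k = al.

Lemma monomialE al J x : (mlen al <= J)%N ->
  monomial e al x = \prod_(i < J) coef e i x ^+ al i.
Proof.
move=> aJ; rewrite /monomial (@big_finsupp _ _ _ al (fun i => coef e i x ^+ al i) J)//.
  by move=> i /mlen_gt iJ; exact: leq_trans iJ aJ.
by move=> i ->; rewrite expr0.
Qed.

Lemma monomial_succ al j : exists be, forall x, monomial e be x = coef e j x * monomial e al x.
Proof.
pose be : multiindex := [fsfun al with j |-> (al j).+1]; exists be => x.
pose J := maxn (maxn (mlen al) (mlen be)) j.+1.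
have jJ : (j < J)%N by rewrite leq_max leqnn orbT.
rewrite !(@monomialE _ J) ?leq_max ?leqnn ?orbT//.
rewrite !(bigD1 (Ordinal jJ) (P := xpredT))//= mulrA -exprS fsfun_withE eqxx; congr (_ * _).
by apply: eq_bigr => i; rewrite -val_eqE fsfun_withE /= => /negbTE ->.
Qed.

Lemma monomial_zero : exists al, forall x, monomial e al x = 1.
Proof. by exists [fsfun] => x; rewrite /monomial finsupp0 big_nil. Qed.

Definition polynomial (g : V -> K) := exists r a, forall x, g x = msum e A a r x.

Let pad (a : nat -> K) r k := if (k < r)%N then a k else 0.

Let msum_pad a r n x : (r <= n)%N -> msum e A a r x = msum e A (pad a r) n x.
Proof.
move=> rn; rewrite /msum (big_ord_widen n (fun k => a k * monomial e (A k) x) rn).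
by rewrite big_mkcond; apply: eq_bigr => k _; rewrite /pad; case: ifP; rewrite ?mul0r.
Qed.

Lemma eq_polynomial g g' : (forall x, g x = g' x) -> polynomial g' -> polynomial g.
Proof. by move=> gg' [r [a Ha]]; exists r, a => x; rewrite gg'. Qed.

Lemma polynomialD g g' : polynomial g -> polynomial g' -> polynomial (fun x => g x + g' x).
Proof.
move=> [r [a Ha]] [r' [a' Ha']].
exists (maxn r r'), (fun k => pad a r k + pad a' r' k) => x.
rewrite Ha Ha' (msum_pad a x (leq_maxl r r')) (msum_pad a' x (leq_maxr r r')).
by rewrite /msum -big_split; apply: eq_bigr => k _; rewrite mulrDl.
Qed.

Lemma polynomialZ c g : polynomial g -> polynomial (fun x => c * g x).
Proof.
move=> [r [a Ha]]; exists r, (fun k => c * a k) => x.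
by rewrite Ha /msum mulr_sumr; apply: eq_bigr => k _; rewrite mulrA.
Qed.

Lemma polynomial0 : polynomial (fun=> 0).
Proof. by exists 0%N, (fun=> 0) => x; rewrite /msum big_ord0. Qed.

Lemma polynomial_sum n (g : 'I_n -> V -> K) : (forall i, polynomial (g i)) ->
  polynomial (fun x => \sum_(i < n) g i x).
Proof.
elim: n g => [|n ih] g pg.
  by apply: eq_polynomial polynomial0 => x; rewrite big_ord0.
apply: eq_polynomial (polynomialD (pg ord0) (ih _ (fun i => pg (lift ord0 i)))) => x.
by rewrite big_ord_recl.
Qed.

Lemma polynomial_monomial al : polynomial (monomial e al).
Proof.
have [k Ak] := A_surj al; exists k.+1, (fun i => (i == k)%:R) => x.
rewrite /msum big_ord_recr /= eqxx mul1r Ak big1 ?add0r// => i _.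
by rewrite (ltn_eqF (ltn_ord i)) mul0r.
Qed.

Lemma polynomial_cst c : polynomial (fun=> c).
Proof.
have [al H] := monomial_zero.
by apply: eq_polynomial (polynomialZ c (polynomial_monomial al)) => x; rewrite H mulr1.
Qed.

Lemma polynomial_coefM j g : polynomial g -> polynomial (fun x => coef e j x * g x).
Proof.
move=> [r [a Ha]].
pose G (k : 'I_r) x := a k * (coef e j x * monomial e (A k) x).
apply: (@eq_polynomial _ (fun x => \sum_(k < r) G k x)) => [x|].
  by rewrite Ha /msum mulr_sumr; apply: eq_bigr => k _; rewrite mulrCA.
apply: polynomial_sum => k; apply: polynomialZ.
have [be H] := monomial_succ (A k) j.
by apply: eq_polynomial (polynomial_monomial be) => x; rewrite H.
Qed.

Lemma polynomial_coefX j k g : polynomial g -> polynomial (fun x => coef e j x ^+ k * g x).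
Proof.
move=> pg; elim: k => [|k ih].
  by apply: eq_polynomial pg => x; rewrite expr0 mul1r.
by apply: eq_polynomial (polynomial_coefM j ih) => x; rewrite exprS mulrA.
Qed.

Lemma truncS j x : trunc e j.+1 x = trunc e j x + coef e j x *: e j.
Proof. by rewrite /trunc big_ord_recr. Qed.

Lemma trunc_continuous j : continuous (trunc e j).
Proof.
apply: (@lipschitz_continuous _ _ _ _ 1) => // x y; rewrite mul1r !(truncE he hu).
rewrite -(multB he hu); last exact: indic_le1.
by apply: (norm_mult he hu); exact: indic_le1.
Qed.

Lemma replace_coord_trunc j x w : replace_coord j (trunc e j.+1 x) w = trunc e j x + w *: e j.
Proof.
by rewrite /replace_coord (coef_trunc he hu) ltnSn mul1r truncS addrK.
Qed.

(** Induction on the number of coordinates. Interpolation in the last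
    coordinate expresses [f] through its translates by the nodes, which are
    entire functions of one coordinate less, with coefficients that are powers
    of the last coordinate. *)
Lemma trunc_approx C : compact C -> forall j f (r : K), frechet_entire f -> 0 < r ->
  exists g, polynomial g /\ forall x, C x -> `|f (trunc e j x) - g x| <= r.
Proof.
move=> cC; elim=> [|j ih] f r df r0.
  exists (fun=> f 0); split; first exact: polynomial_cst.
  by move=> x _; rewrite /trunc big_ord0 subrr normr0 ltW.
have [B B0 HB] := bounded_on_compact (@coef_continuous j) cC.
(* the geometric sums are controlled on the disc of half the radius *)
pose rho := 2 * B; have rho0 : 0 < rho by rewrite mulr_gt0.
have cC1 : compact (trunc e j.+1 @` C).
  by apply: continuous_compact cC; exact/continuous_subspaceT/trunc_continuous.
have r2 : 0 < r / 2 by rewrite divr_gt0.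
have C2 y : (trunc e j.+1 @` C) y -> `|coef e j y| <= rho / 2.
  move=> [x Cx <-]; rewrite (coef_trunc he hu) ltnSn mul1r /rho.
  by rewrite mulrAC divff ?mul1r ?pnatr_eq0//; exact: HB.
have [N HN] := interpolate_uniform rho0 df cC1 C2 r2.
pose w t := rho * zeta N t.
have r8 : 0 < r / 8 by rewrite divr_gt0.
have /choice[g Hg] (t : 'I_(2 ^ N)) : exists g, polynomial g /\
    forall x, C x -> `|f (trunc e j x + w t *: e j) - g x| <= r / 8.
  apply: (ih (fun y => f (y + w t *: e j)) _ _ r8) => x.
  apply: (@differentiable_comp _ _ _ _ (fun y => y + w t *: e j) f); last exact: df.
  exact: differentiableD.
exists (fun x => (2 ^+ N)^-1 * \sum_(t < 2 ^ N) g t x * geom (2 ^ N) (coef e j x / w t)).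
split.
  apply/polynomialZ/polynomial_sum => t.
  apply: (@eq_polynomial _ (fun x => \sum_(k < 2 ^ N) (w t)^-1 ^+ k * (coef e j x ^+ k * g t x))).
    move=> x; rewrite mulrC /geom mulr_suml; apply: eq_bigr => k _.
    by rewrite exprMn; ring.
  apply: polynomial_sum => k; apply/polynomialZ/polynomial_coefX.
  by case: (Hg t).
move=> x Cx; apply: le_trans (ler_distD (interpolate j rho N f (trunc e j.+1 x)) _ _) _.
rewrite (splitr r); apply: lerD; first by apply/ltW/HN; exists x.
rewrite /interpolate /interpolant -mulrBr -sumrB (coef_trunc he hu) ltnSn mul1r.
have P0 : 0 < 2 ^+ N :> K by rewrite exprn_gt0.
rewrite normrM gtr0_norm ?invr_gt0// ler_pdivrMl//.
apply: le_trans (ler_norm_sum _ _ _) _.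
apply: (@le_trans _ _ (\sum_(t < 2 ^ N) (r / 2))); last first.
  by rewrite sumr_const card_ord -[leLHS]mulr_natl natrX.
apply: ler_sum => t _; rewrite replace_coord_trunc -/(w t) -mulrBl normrM.
have -> : r / 2 = r / 8 * 4 by field.
apply: ler_pM => //; first by case: (Hg t) => _; apply.
apply: norm_geom; rewrite normrM normfV /w normrM norm_zeta mulr1 (gtr0_norm rho0).
by rewrite ler_pdivrMr// /rho mulrA mulVf ?pnatr_eq0// mul1r; exact: HB.
Qed.

(** The truncations converge to the identity uniformly on compact sets because
    they have norm at most one. *)
Theorem polynomial_dense f C (r : K) : frechet_entire f -> compact C -> 0 < r ->
  exists g, polynomial g /\ forall x, C x -> `|f x - g x| <= r.
Proof.
move=> df cC r0.
have r2 : 0 < r / 2 by rewrite divr_gt0.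
have r4 : 0 < r / 2 / 2 by rewrite divr_gt0.
have cf : continuous f by move=> x; exact: differentiable_continuous.
have H : \forall j \near \oo, C `<=` (fun x => `|f x - f (trunc e j x)| < r / 2).
  have /compact_near_coveringP := cC; apply => x0 Cx0.
  have /cvgrPdist_lt/(_ _ r4) /nbhs_ballP[d /= d0 Hd] := cf x0.
  have d2 : 0 < d / 2 by rewrite divr_gt0.
  have /cvgrPdist_lt/(_ _ d2) Ht := trunc_cvg he (x := x0).
  exists (ball x0 (d / 2), [set j | `|x0 - trunc e j x0| < d / 2]).
    by split=> //; exact: nbhsx_ballx.
  move=> -[x j] [/= + xj]; rewrite -ball_normE /= => xx.
  apply: le_lt_trans (ler_distD (f x0) _ _) _; rewrite (splitr (r / 2)).
  apply: ltrD.
    rewrite distrC; apply: Hd; rewrite -ball_normE /=; apply: lt_trans xx _.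
    by rewrite ltr_pdivrMr// ltr_pMr// ltr1n.
  apply: Hd; rewrite -ball_normE /=.
  apply: le_lt_trans (ler_distD (trunc e j x0) _ _) _; rewrite (splitr d).
  apply: ltrD => //; rewrite !(truncE he hu) -(multB he hu); last exact: indic_le1.
  apply: le_lt_trans xx.
  by apply: (norm_mult he hu); exact: indic_le1.
have [j _ /(_ j (leqnn j)) Hj] := H.
have [g [pg Hg]] := trunc_approx cC j df r2.
exists g; split=> // x Cx; apply: le_trans (ler_distD (f (trunc e j x)) _ _) _.
by rewrite (splitr r); apply: lerD; [exact/ltW/Hj|exact: Hg].
Qed.

End Density.

(** * The monomial basis *)

Section MonomialsHolomorphic.
Local Open Scope ring_scope.
Context {K : numFieldType} {V : normedModType K} (e : nat -> V).
Hypothesis he : schauder_basis e.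

Lemma differentiable_coef j x : differentiable (coef e j : V -> K^o) x.
Proof.
have lin : linear (coef e j : V -> K^o) by move=> k u v; exact: coef_lin.
pose f : {linear V -> K^o} := HB.pack (coef e j : V -> K^o)
  (GRing.isLinear.Build _ _ _ _ (coef e j : V -> K^o) lin).
exact: (@linear_differentiable _ _ _ f x (he.2 j)).
Qed.

Lemma monomial_holomorphic al : (monomial e al : V -> K^o) \in @holomorphic K V.
Proof.
apply/asboolP => x; rewrite (_ : monomial e al =
  fun x => \prod_(j <- finsupp al) coef e j x ^+ al j : K^o)//.
elim: (finsupp al : seq nat) => [|j s ih].
  by under eq_fun do rewrite big_nil; exact: differentiable_cst.
under eq_fun do rewrite big_cons.
apply: (@differentiableM _ _ (fun x => coef e j x ^+ al j)) => //.
elim: (al j) => [|k ihk].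
  by under eq_fun do rewrite expr0; exact: differentiable_cst.
under eq_fun do rewrite exprS.
exact: (@differentiableM _ _ (coef e j) _ _ (differentiable_coef j x) ihk).
Qed.

Definition holo_monomial al : holo V := Holo (monomial_holomorphic al).

End MonomialsHolomorphic.

Section ComplexFacts.
Local Open Scope classical_set_scope.
Local Open Scope ring_scope.
Local Open Scope complex_scope.
Context {R : realType}.
Local Notation K := R[i].

Lemma norm_zeta N k : `|zeta N k : K| = 1.
Proof. by rewrite normCE normc_zeta. Qed.

Lemma cdiff_entire (h : K -> K) : entire h -> cdiff h.
Proof.
move=> hd u0; have [A HA] := hd u0; exists A => r r0.
have [|_ /complex_gt0_real[d d0 ->] Hd] := HA r%:C; first by rewrite ltcR.
exists d => // u ud; have := Hd u.
by rewrite !normCE ltcR -rmorphM lecR; apply.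
Qed.

Lemma interpolant_cvg (rho : K) (h : K -> K) z (r : K) : entire h -> 0 < rho ->
  `|z| <= rho / 2 -> 0 < r ->
  exists N0, forall N, (N0 <= N)%N -> `|interpolant zeta N rho h z - h z| < r.
Proof.
move=> /cdiff_entire hd /complex_gt0_real[q q0 ->] zr /complex_gt0_real[s s0 ->].
have zq : normc z <= q / 2.
  by move: zr; rewrite normCE -(rmorph_nat (real_complex R)) -fmorphV -rmorphM lecR.
have [N0 HN0] := interpolant_normc_cvg hd q0 zq s0.
by exists N0 => N /HN0; rewrite -ltcR -normCE.
Qed.

End ComplexFacts.

Section MonomialBasis.
Local Open Scope classical_set_scope.
Local Open Scope ring_scope.
Context {R : realType}.
Local Notation K := R[i].

(** The compact set that controls the partial sums on [C] is the double of the
    solid hull of [C]. At the sum of the first basis vectors, as many as the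
    length of the multi-index, the monomial takes the value one. *)
Theorem monomial_basis (V : completeNormedModType K) (b : nat -> V)
    (hb : one_unconditional_basis b) (A : nat -> multiindex) (hA : compatible A) :
  exists m : nat -> holo V,
    (forall n x, m n x = monomial b (A n) x) /\ schauder_basis m.
Proof.
have [sb ub] := hb.
pose m n := holo_monomial sb (A n).
have mE n x : m n x = monomial b (A n) x by [].
exists m; split=> //.
have psumE a r x : psum m a r x = msum b A a r x by [].
have A_surj al : exists k, A k = al.
  by have [B _ BK] := hA.1; exists (B al).
apply: schauder_criterion.
- move=> C cC; pose H := solid_hull b C.
  have cH : compact H := compact_solid_hull sb ub (@compact_disc R) cC.
  have sH : solid b H by move=> l x l1 Hx; exact: solid_hull_mult.
  exists [set 2 *: y | y in H], 4; split=> //.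
    by apply: continuous_compact cH; exact/continuous_subspaceT/scaler_continuous.
  move=> a q r B qr aB x Cx.
  apply: (msum_bound sb ub (@norm_zeta R) (@zeta_mean R) hA sH qr (a := a)) => [y Hy|].
    by apply: aB; exists y.
  exact: sub_solid_hull.
- move=> k; pose x := \sum_(j < mlen (A k)) b j; exists x.
  rewrite mE (monomialE _ _ (leqnn _)) big1 ?oner_eq0// => i _.
  rewrite (coef_sum sb) (bigD1 i)//= (coef_basis sb) eqxx big1 ?addr0 ?expr1n// => j ji.
  by rewrite (coef_basis sb) eq_sym -val_eqE in ji *; rewrite (negbTE ji).
move=> f C r cC r0.
have df : frechet_entire f by case: (f) => g /= /asboolP.
have [g [[n [a Ha]] Hg]] := polynomial_dense sb ub (@norm_zeta R) (@interpolant_cvg R)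
  (@compact_disc R) (@compact_bounded_fun R) A_surj df cC r0.
exists (fun k => if (k < n)%N then a k else 0), n; split.
  by move=> k; rewrite leqNgt => /negbTE ->.
move=> x Cx; have := Hg x Cx; rewrite Ha; congr (`|_ - _| <= _).
by apply: eq_bigr => k _; rewrite ltn_ord.
Qed.

End MonomialBasis.

Theorem proposition6p3 (R : realType) (E : solidSeqSpace R[i])
    (X : nat -> completeNormedModType R[i]) (e : forall j : nat, nat -> X j)
    (he : forall j : nat, one_unconditional_basis (e j))
    (sigma : nat -> nat * nat) (hsigma : bijective sigma) :
  let b : nat -> bsum E X :=
    fun n => bsum_in E (e (sigma n).1 (sigma n).2) in
  one_unconditional_basis b /\
  forall A : nat -> multiindex, compatible A ->
    exists m : nat -> holo (bsum E X),
      (forall n x, m n x = monomial b (A n) x) /\ schauder_basis m.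
Proof.
have hb := sum_basis_unconditional E he hsigma.
split; first exact: hb.
by move=> A hA; exact: (monomial_basis hb hA).
Qed.
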